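(* Let $(\mathscr{X}_N^S)_{N\ge 1}$ be the spherical ensemble on $\mathbb{S}^2$ (the process $\mathscr{X}_N^S$ samples $N$ points). Then it is hyperuniform in all three regimes (with $d=2$), that is: (i) (large caps) for every fixed $\phi\in(0,\frac{\pi}{2})$, $V(\mathscr{X}_N^S,\phi)=o(N)$ as $N\to\infty$; (ii) (small caps) for every sequence $(\phi_N)_{N\in\mathbb{N}}$ of opening angles with $\lim_{N\to\infty}\phi_N=0$ and $\lim_{N\to\infty}N\sigma(C(\phi_N))=\infty$, $V(\mathscr{X}_N^S,\phi_N)=o\left(N\sigma(C(\phi_N))\right)$ as $N\to\infty$; (iii) (threshold order) $\limsup_{N\to\infty}V(\mathscr{X}_N^S,tN^{-\frac12})=\mathcal{O}(t)$ as $t\to\infty$.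
   Context: $\mathbb{S}^2\subset\mathbb{R}^3$ is the unit sphere and $\sigma$ its normalised surface area measure. For $\mathbf{x}\in\mathbb{S}^2$, $C(\mathbf{x},\phi)=\{\mathbf{y}\in\mathbb{S}^2 : \langle\mathbf{x},\mathbf{y}\rangle>\cos\phi\}$ is the open spherical cap with center $\mathbf{x}$ and opening angle $\phi$; $\sigma(C(\phi))$ denotes $\sigma(C(\mathbf{x},\phi))$, which does not depend on $\mathbf{x}$. A point process $\mathscr{X}_N$ sampling $N$ points on the sphere is given by exchangeable random points $X_1,\dots,X_N$ (almost surely pairwise distinct) with joint density $\rho^{(N)}$ with respect to $\sigma^{\otimes N}$; for measurable $B$, $\mathscr{X}_N(B)=\sum_{i=1}^N\mathbb{1}_B(X_i)$. The number variance is $V(\mathscr{X}_N,\phi)=\mathbb{V}\,\mathscr{X}_N(C(\cdot,\phi))=\mathbb{E}\left(\mathscr{X}_N(C(\cdot,\phi))^2\right)-\left(\mathbb{E}\mathscr{X}_N(C(\cdot,\phi))\right)^2$, where the expectation includes integration of the center of the cap with respect to $\sigma$; if the process is rotation invariant (as is the spherical ensemble), this integration can be omitted and any fixed center can be used. The process is determinantal with kernel $K$ if for $1\le k\le N$ its reduced densities $\rho_k^{(N)}$ (obtained from $\rho^{(N)}$ by integrating out $N-k$ of the variables with respect to $\sigma$) are given by $\rho^{(N)}_k(\mathbf{x}_1,\dots,\mathbf{x}_k)=\frac{(N-k)!}{N!}\det(K(\mathbf{x}_i,\mathbf{x}_j))_{i,j=1}^k$. The spherical ensemble $\mathscr{X}_N^S$: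 take independent $N\times N$ matrices $A$ and $B$ with i.i.d. standard complex Gaussian entries and project the $N$ eigenvalues of $A^{-1}B$ stereographically from $\mathbb{C}$ to $\mathbb{S}^2$, where the stereographic projection is $\mathbf{x}=(x_1,x_2,x_3)\mapsto\frac{x_1+ix_2}{1-x_3}$. Equivalently, it is the determinantal point process on $\mathbb{S}^2$ (with respect to $\sigma$) with kernel $$K_N(\mathbf{x},\mathbf{y})=\frac{N}{2^{N-1}}\left(\frac{1+\langle\mathbf{x},\mathbf{y}\rangle-x_3-y_3+i(x_2y_1-x_1y_2)}{\sqrt{(1-x_3)(1-y_3)}}\right)^{N-1}.$$ *)

(* Defs.v *)
From HB Require Import structures.
From mathcomp Require Import all_boot all_order all_algebra all_fingroup.
From mathcomp Require Import all_classical all_reals all_analysis.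
From mathcomp Require Import measurable_realfun.
From mathcomp Require Import complex lra.

Set Implicit Arguments.
Unset Strict Implicit.
Unset Printing Implicit Defensive.

Import Order.TTheory GRing.Theory Num.Theory.
Import numFieldNormedType.Exports.

Local Open Scope classical_set_scope.
Local Open Scope ring_scope.
Local Open Scope complex_scope.

Notation space3 R :=
  ((measurableTypeR R * measurableTypeR R) * measurableTypeR R)%type.

Lemma mnormalizeE d (T : measurableType d) (R : realType)
    (mu : {measure set T -> \bar R}) (P : probability T R) (U : set T) :
  (0 < mu setT < +oo)%E -> mnormalize mu P U = (mu U / mu setT)%E.
Proof.
move=> /andP[mu0 muoo]; rewrite /mnormalize gt_eqF//= lt_eqF//=.
have fmu : mu setT \is a fin_num by rewrite ge0_fin_numE// ltW.
by rewrite -[in RHS](fineK fmu) inver gt_eqF// fine_gt0// mu0.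
Qed.

Section Sphere.
Context {R : realType}.
Implicit Types x y : space3 R.

Definition dot x y : R := x.1.1 * y.1.1 + x.1.2 * y.1.2 + x.2 * y.2.

Definition enorm x : R := Num.sqrt (dot x x).

Definition sphere : set (space3 R) := [set x | enorm x = 1].

Definition cap x (phi : R) : set (space3 R) :=
  [set y | sphere y /\ cos phi < dot x y].

Definition unit_ball : set (space3 R) := [set x | enorm x <= 1].

Definition north : space3 R := ((0, 0), 1).

Definition radial_proj x : space3 R :=
  ((x.1.1 / enorm x, x.1.2 / enorm x), x.2 / enorm x).

Lemma measurable_dotxx : measurable_fun setT (fun x => dot x x).
Proof.
have m1 : measurable_fun setT (fun x => x.1.1).
  exact: (measurableT_comp measurable_fst measurable_fst).
have m2 : measurable_fun setT (fun x => x.1.2).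
  exact: (measurableT_comp measurable_snd measurable_fst).
by apply: measurable_funD; [apply: measurable_funD|]; apply: measurable_funM.
Qed.

Lemma measurable_enorm : measurable_fun setT enorm.
Proof.
apply: measurableT_comp measurable_dotxx.
by apply: continuous_measurable_fun; exact: sqrt_continuous.
Qed.

Lemma measurable_unit_ball : measurable unit_ball.
Proof.
rewrite (_ : unit_ball = setT `&` enorm @^-1` `]-oo, 1]%classic).
  exact: measurable_enorm.
by apply/seteqP; split => x; rewrite /unit_ball /= in_itv//= => -[].
Qed.

Lemma measurable_radial_proj : measurable_fun setT radial_proj.
Proof.
have enormV : measurable_fun setT (fun x => (enorm x)^-1).
  rewrite (_ : (fun _ => _) = (fun x => enorm x `^ (-1))).
    exact: (measurableT_comp (measurable_powR _) measurable_enorm).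
  by apply/funext => x; rewrite powR_inv1// sqrtr_ge0.
have m1 : measurable_fun setT (fun x => x.1.1).
  exact: (measurableT_comp measurable_fst measurable_fst).
have m2 : measurable_fun setT (fun x => x.1.2).
  exact: (measurableT_comp measurable_snd measurable_fst).
apply: measurable_fun_pair; [apply: measurable_fun_pair|];
  exact: measurable_funM.
Qed.

HB.instance Definition _ :=
  isMeasurableFun.Build _ _ _ _ radial_proj measurable_radial_proj.

Definition lebesgue3 : {measure set (space3 R) -> \bar R} :=
  ((lebesgue_measure \x lebesgue_measure) \x lebesgue_measure)%E.

Definition unif_ball : probability (space3 R) R :=
  mnormalize (mrestr lebesgue3 measurable_unit_ball) (dirac north).

(* Normalised surface area measure on the unit sphere, seen as a measure on R^3
   carried by the sphere.  The surface area of B is 3 times the volume of the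
   solid cone {t *: y | 0 < t <= 1, y \in B}; after normalisation sigma B is the
   proportion of the unit ball taken by that cone (see sigmaE below).  The
   default branch of mnormalize is never taken, since the ball has positive
   finite volume (lebesgue3_unit_ball). *)
Definition sigma : probability (space3 R) R :=
  distribution unif_ball radial_proj.

Lemma lebesgue3_unit_ball : (0 < lebesgue3 unit_ball < +oo)%E.
Proof.
have box (a b : R) (I : set (measurableTypeR R) := `[a, b]%classic) : a < b ->
    measurable ((I `*` I) `*` I) /\
    lebesgue3 ((I `*` I) `*` I) = ((b - a) ^+ 3)%:E.
  move=> ab; have mI : measurable I by exact: measurable_itv.
  have mII : measurable (I `*` I) by exact: measurableX.
  split; first exact: measurableX.
  have lI : (lebesgue_measure I = (b - a)%:E)%E.
    by rewrite /I (lebesgue_measure_itv `[a, b]) /= lte_fin ab.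
  transitivity (((lebesgue_measure \x lebesgue_measure) (I `*` I)) *
                lebesgue_measure I)%E.
    exact: product_measure1E.
  transitivity (((lebesgue_measure I * lebesgue_measure I)) *
                lebesgue_measure I)%E.
    by congr (_ * _)%E; exact: product_measure1E.
  by rewrite lI -!EFinM -expr2 -exprSr.
apply/andP; split.
  have [mA lA] := box 0 2^-1 (ltac:(by rewrite invr_gt0 ltr0n)).
  apply: (@lt_le_trans _ _ ((2^-1 - 0) ^+ 3)%:E).
    by rewrite lte_fin subr0 exprn_gt0// invr_gt0 ltr0n.
  rewrite -lA; apply: le_measure; rewrite ?inE//.
    exact: measurable_unit_ball.
  move=> [[x1 x2] x3] /= [[]] /=; rewrite !in_itv /= => /andP[? ?] /andP[? ?].
  move=> /andP[? ?]; rewrite /unit_ball /enorm /dot /= -[leRHS]sqrtr1.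
  by rewrite ler_wsqrtr//; nra.
have [mA lA] := box (- 1) 1 (ltac:(by lra)).
apply: (@le_lt_trans _ _ ((1 - - 1) ^+ 3)%:E); last exact: ltry.
rewrite -lA; apply: le_measure; rewrite ?inE//.
  exact: measurable_unit_ball.
move=> [[x1 x2] x3]; rewrite /unit_ball /enorm /dot /= -[leRHS]sqrtr1.
rewrite ler_sqrt// => h.
by split => /=; [split => /=|]; rewrite in_itv /=; apply/andP; split; nra.
Qed.

Lemma sigmaE (B : set (space3 R)) :
  sigma B = (lebesgue3 (radial_proj @^-1` B `&` unit_ball) /
             lebesgue3 unit_ball)%E.
Proof.
have e : mrestr lebesgue3 measurable_unit_ball setT = lebesgue3 unit_ball.
  exact: congr1 (setTI unit_ball).
have h : (0 < mrestr lebesgue3 measurable_unit_ball setT < +oo)%E.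
  by move: lebesgue3_unit_ball; rewrite -e.
by apply: eq_trans (mnormalizeE (dirac north) _ h) _; congr (_ / _)%E.
Qed.

End Sphere.

Section ProductMeasure.
Context d (T : measurableType d) (R : realType).

Section Pair.
Context d2 (T2 : measurableType d2).
Variables (P : probability T R) (Q : probability T2 R).

Lemma prod_probT : (P \x Q)%E setT = 1%E.
Proof.
rewrite -setXTT; transitivity (P setT * Q setT)%E.
  exact: product_measure1E.
by rewrite !probability_setT mule1.
Qed.

HB.instance Definition _ :=
  Measure_isProbability.Build _ _ _ (P \x Q)%E prod_probT.
End Pair.

Definition consp n (xs : T * n.-tuple T) : n.+1.-tuple T :=
  [tuple of xs.1 :: xs.2].

Lemma measurable_consp n : measurable_fun setT (@consp n).
Proof. exact: measurable_cons. Qed.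

HB.instance Definition _ n :=
  isMeasurableFun.Build _ _ _ _ (@consp n) (@measurable_consp n).

(* n-fold product of P with itself. *)
Fixpoint powerP (P : probability T R) n : probability (n.-tuple T) R :=
  if n is m.+1 then distribution (P \x powerP P m)%E (@consp m)
  else dirac [tuple].

End ProductMeasure.

Section PointProcess.
Context {R : realType}.
Local Notation E3 := (space3 R).

(* N exchangeable, almost surely distinct random points on the sphere, given with
   (a version of) their joint density with respect to the N-th power of sigma. *)
Record point_process (N : nat) := PointProcess {
  pp_disp : measure_display;
  pp_space : measurableType pp_disp;
  pp_prob : probability pp_space R;
  pp_points : {RV pp_prob >-> N.-tuple E3};
  pp_on_sphere : forall w i, sphere (tnth (pp_points w) i);
  pp_distinct : {ae pp_prob, forall w, uniq (pp_points w)};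
  pp_exchangeable : forall (s : 'S_N) (B : set (N.-tuple E3)), measurable B ->
    pp_prob [set w | B [tuple tnth (pp_points w) (s i) | i < N]] =
    pp_prob (pp_points @^-1` B);
  pp_density : {mfun N.-tuple E3 >-> R};
  pp_density_ge0 : forall x, 0 <= pp_density x;
  pp_densityP : forall B : set (N.-tuple E3), measurable B ->
    distribution pp_prob pp_points B =
    (\int[powerP sigma N]_(x in B) (pp_density x)%:E)%E
}.

Definition count_in N (B : set E3) (xs : N.-tuple E3) : R :=
  \sum_(i < N) \1_B (tnth xs i).

(* The centre c of the cap is averaged with respect to sigma in both moments.
   All quantities are finite, since counts are bounded by N. *)
Definition number_variance N (X : point_process N) (phi : R) : R :=
  (\int[sigma]_c
     fine 'E_(pp_prob X)[fun w => count_in (cap c phi) (pp_points X w) ^+ 2])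
  - (\int[sigma]_c
       fine 'E_(pp_prob X)[fun w => count_in (cap c phi) (pp_points X w)]) ^+ 2.

(* The last N - k variables are integrated out. *)
Definition reduced_density N (X : point_process N) k (kN : (k <= N)%N)
    (x : k.-tuple E3) : R :=
  \int[powerP sigma (N - k)]_y
    pp_density X (tcast (subnKC kN) [tuple of x ++ y]).

(* Densities are only determined up to null sets, hence the equality holds
   almost everywhere. *)
Definition determinantal N (X : point_process N) (K : E3 -> E3 -> R[i]) :=
  forall k (kN : (k <= N)%N), (0 < k)%N ->
    {ae powerP sigma k, forall x,
      (reduced_density X kN x)%:C =
      (((N - k)`!)%:R / (N`!)%:R) *
      \det (\matrix_(i < k, j < k) K (tnth x i) (tnth x j))}.

(* The kernel is singular when x or y is the north pole (a sigma-null set); there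
   division by zero returns 0. *)
Definition spherical_kernel N (x y : E3) : R[i] :=
  (N%:R / 2 ^+ N.-1) *
  (((1 + dot x y - x.2 - y.2) +i* (x.1.2 * y.1.1 - x.1.1 * y.1.2)) /
   (Num.sqrt ((1 - x.2) * (1 - y.2)))%:C) ^+ N.-1.

(* The law of the stereographic images of the N eigenvalues of A^-1 B, for A and B
   independent N x N complex Ginibre matrices, is the one of the determinantal
   process with this kernel. *)
Definition spherical_ensemble N (X : point_process N) :=
  determinantal X (spherical_kernel N).

(* By rotation invariance of sigma any centre gives the same value. *)
Definition cap_area (phi : R) : R := fine (sigma (cap north phi)).

Definition hyperuniform_large_caps (X : forall N, point_process N) :=
  forall phi : R, 0 < phi < pi / 2 ->
    (fun N => number_variance (X N) phi : R^o) =o_\oo (fun N => N%:R : R^o).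

Definition hyperuniform_small_caps (X : forall N, point_process N) :=
  forall phi : nat -> R, (forall N, 0 <= phi N <= pi) ->
    phi @ \oo --> (0 : R) ->
    (fun N => N%:R * cap_area (phi N)) @ \oo --> +oo ->
    (fun N => number_variance (X N) (phi N) : R^o)
      =o_\oo (fun N => N%:R * cap_area (phi N) : R^o).

(* O(t) as t --> +oo, for an extended-real limsup over N; in particular the limsup
   is finite for all large t. *)
Definition hyperuniform_threshold (X : forall N, point_process N) :=
  exists M : R, \forall t \near +oo,
    (`|limn_esup (fun N =>
         (number_variance (X N) (t / Num.sqrt N%:R))%:E)| <= (M * `|t|)%:E)%E.

End PointProcess.

Arguments point_process R N : clear implicits.

(* Main.v *)
(** Write s(x, y) = (1 + <x, y>) / 2, so that |K_N(x, y)|^2 = N^2 s^(N-1) on the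
    sphere.  The determinantal structure gives

      V(phi) = N^2 E_c [ int_(x in C(c, phi)) int_(y notin C(c, phi)) s(x, y)^(N-1) ].

    Exchanging integrals, a pair (x, y) is weighted by the measure of the centres
    c whose cap contains x but not y.  With r the chord of phi, these c lie in an
    annulus around x of width at most |x - y|, of measure at most r |x - y| / 2 by
    Archimedes' theorem.  As |x - y| = 2 sqrt(1 - s), AM-GM bounds |x - y| by
    sqrt N (1 - s) + 1 / sqrt N, and int s^(N-1) = 1/N, int s^N = 1/(N+1) then yield
    0 <= V(phi) <= r sqrt N.  The three regimes follow from r <= 2, from
    sigma(C(phi)) = r^2 / 4 and from r <= phi. *)

From HB Require Import structures.
Require Import Defs.
From mathcomp Require Import all_boot all_order all_algebra all_fingroup.
From mathcomp Require Import all_classical all_reals all_analysis.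
From mathcomp Require Import measurable_realfun.
From mathcomp Require Import complex ring lra.

Set Implicit Arguments.
Unset Strict Implicit.
Unset Printing Implicit Defensive.

Import Order.TTheory GRing.Theory Num.Theory.
Import numFieldNormedType.Exports.

Local Open Scope classical_set_scope.
Local Open Scope ring_scope.

(** * Shears and Lebesgue measure *)

(** The measure [sigma] comes without surface coordinates: [sigma B] is the proportion of the unit
    ball taken by the cone over B. Statements on caps are therefore carried back to volumes.
    Independence of the centre only requires the joint law of [dot u x] and [dot x x], so that
    rotations in coordinate planes suffice, each a product of shears. Dependence on the height is
    linear because, at a fixed squared norm, the heights in a cone fill an interval; the constants
    of the volumes, pi and 2/3, stay symbolic and cancel.

    The kernel integrals are not computed by calculus either. The two-point law must have the
    one-point law as its marginal, and this consistency forces int s^(N-1) = 1/N. The value of int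
    s^N then comes from the ensemble of N + 1 points, so the bound for one N relies on two members
    of the family. The width |x - y| involves the square root of 1 - s, which this argument does not
    integrate; AM-GM trades it for a combination of 1 and 1 - s, hence for two consecutive powers of
    s, at the cost of a constant factor. *)

Section ProductSections.
Context d1 d2 (T1 : measurableType d1) (T2 : measurableType d2) (R : realType).
Variable m1 : {sigma_finite_measure set T1 -> \bar R}.
Variable m2 : {sigma_finite_measure set T2 -> \bar R}.

Lemma product_measure_xsection (S : set (T1 * T2)) :
  (m1 \x m2)%E S = (\int[m1]_x m2 [set y | S (x, y)])%E.
Proof.
by apply: eq_integral => x _; congr (m2 _); apply/seteqP; split => y /=;
  rewrite /xsection /= inE.
Qed.

Lemma product_measure_ysection (S : set (T1 * T2)) : measurable S ->
  (m1 \x m2)%E S = (\int[m2]_y m1 [set x | S (x, y)])%E.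
Proof.
move=> mS; rewrite (@product_measure_unique _ _ _ _ _ m1 m2 (m1 \x^ m2)%E)//.
  by apply: eq_integral => y _; congr (m1 _); apply/seteqP; split => x /=;
    rewrite /ysection /= inE.
by move=> A B mA mB; exact: product_measure2E.
Qed.

(** Fibrewise invariance: the map keeps the second coordinate, and each [f y] preserves the measure
    of the fibre over y. Joint measurability of [f] makes the preimage measurable, as integration
    over the second variable first requires. Both shears and rotations about the third axis have
    this form. *)
Lemma product_measure_preimage_fst (f : T2 -> T1 -> T1) (S : set (T1 * T2)) :
  measurable_fun setT (fun p : T1 * T2 => f p.2 p.1) ->
  (forall y A, measurable A -> m1 (f y @^-1` A) = m1 A) ->
  measurable S ->
  (m1 \x m2)%E [set p | S (f p.2 p.1, p.2)] = (m1 \x m2)%E S.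
Proof.
move=> mf fm1 mS.
have mg : measurable_fun setT (fun p : T1 * T2 => (f p.2 p.1, p.2)).
  exact: measurable_fun_pair.
rewrite !product_measure_ysection//; last first.
  by rewrite -[X in measurable X]setTI; exact: mg.
apply: eq_integral => y _; rewrite -(fm1 y [set x | S (x, y)])//.
rewrite (_ : [set x | S (x, y)] = ysection S y); first exact: measurable_ysection.
by apply/seteqP; split => x; rewrite /ysection /= inE.
Qed.

Lemma product_measure_preimage_snd (f : T1 -> T2 -> T2) (S : set (T1 * T2)) :
  (forall x A, measurable A -> m2 (f x @^-1` A) = m2 A) ->
  measurable S ->
  (m1 \x m2)%E [set p | S (p.1, f p.1 p.2)] = (m1 \x m2)%E S.
Proof.
move=> fm2 mS; rewrite !product_measure_xsection.
apply: eq_integral => x _; rewrite -(fm2 x [set y | S (x, y)])//.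
rewrite (_ : [set y | S (x, y)] = xsection S x); first exact: measurable_xsection.
by apply/seteqP; split => y; rewrite /xsection /= inE.
Qed.

End ProductSections.
Arguments product_measure_preimage_fst {d1 d2 T1 T2 R} m1 m2 f [S].
Arguments product_measure_preimage_snd {d1 d2 T1 T2 R} m1 m2 f [S].

Section LebesgueAffine.
Context {R : realType}.
Local Notation L := (@lebesgue_measure R).
Implicit Types A : set (measurableTypeR R).

(** Uniqueness of Lebesgue measure: its pushforward along the translation has the same values on
    half-open intervals. The dilation below is treated alike, with the pushforward rescaled by
    [k]. *)
Lemma lebesgue_measure_translation (a : R) A : measurable A ->
  L [set x | A (x + a)] = L A.
Proof.
move=> mA.
have mf : measurable_fun [set: measurableTypeR R]
    (fun x : measurableTypeR R => x + a : measurableTypeR R).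
  exact: measurable_funD.
pose f : {mfun measurableTypeR R >-> measurableTypeR R} :=
  HB.pack (fun x : R => x + a) (isMeasurableFun.Build _ _ _ _ _ mf).
rewrite [RHS](@lebesgue_measure_unique _ (pushforward L f))// => _ [[u v] _ <-] /=.
rewrite /pushforward /=.
rewrite (_ : _ @^-1` _ = `]u - a, v - a]%classic); last first.
  by apply/seteqP; split => x /=; rewrite !in_itv/= ltrBlDr lerBrDr.
rewrite !lebesgue_measure_itv/= !lte_fin ltrD2r.
by case: ifP => // _; rewrite -!EFinD; congr EFin; ring.
Qed.

Lemma lebesgue_measure_dilation (k : R) A : 0 < k -> measurable A ->
  (k%:E * L [set x | A (k * x)%R])%E = L A.
Proof.
move=> k0 mA.
have mf : measurable_fun [set: measurableTypeR R]
    (fun x : measurableTypeR R => k * x : measurableTypeR R).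
  exact: measurable_funM.
pose f : {mfun measurableTypeR R >-> measurableTypeR R} :=
  HB.pack (fun x : R => k * x) (isMeasurableFun.Build _ _ _ _ _ mf).
pose k' := NngNum (ltW k0).
rewrite [RHS](@lebesgue_measure_unique _ (mscale k' (pushforward L f)))//.
move=> _ [[u v] _ <-] /=.
rewrite /mscale /= /pushforward /=.
rewrite (_ : _ @^-1` _ = `]u / k, v / k]%classic); last first.
  by apply/seteqP; split => x /=; rewrite !in_itv/= ltr_pdivrMr// ler_pdivlMr// mulrC.
rewrite !lebesgue_measure_itv/= !lte_fin ltr_pM2r ?invr_gt0//.
case: ifP => _; last by rewrite mule0.
by rewrite -!EFinD -EFinM; congr EFin; field; rewrite gt_eqF.
Qed.

End LebesgueAffine.

Lemma measurable_preim d1 d2 (T1 : measurableType d1) (T2 : measurableType d2)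
    (f : T1 -> T2) (S : set T2) :
  measurable_fun setT f -> measurable S -> measurable [set x | S (f x)].
Proof. by move=> mf mS; rewrite -[X in measurable X]setTI; exact: mf. Qed.

Section Lebesgue2.
Context {R : realType}.
Local Notation L := (@lebesgue_measure R).
Local Notation plane := (measurableTypeR R * measurableTypeR R)%type.

(* The product measure already carries a finiteness structure that requires
   probability factors; the alias gives room for the sigma-finite one. *)
Definition lebesgue2 : set plane -> \bar R := (L \x L)%E.

HB.instance Definition _ := Measure.copy lebesgue2 (L \x L)%E.

Lemma lebesgue2_sigma_finite : sigma_finite setT lebesgue2.
Proof.
pose I n : set (measurableTypeR R) := `[- n%:R, n%:R]%classic.
have inI (x : R) n : (Num.truncn `|x| < n)%N -> I n x.
  by move=> xn; rewrite /I /= in_itv /= -ler_norml ltW// -truncn_lt_nat.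
exists (fun n => I n `*` I n).
  apply/seteqP; split => // -[x y] _.
  exists (maxn (Num.truncn `|x|) (Num.truncn `|y|)).+1 => //.
  by split; apply: inI; rewrite ltnS ?leq_maxl ?leq_maxr.
move=> n; have mI : measurable (I n) by exact: measurable_itv.
split; first exact: measurableX.
have -> : lebesgue2 (I n `*` I n) = (L (I n) * L (I n))%E.
  exact: product_measure1E.
by rewrite /I lebesgue_measure_itv /=; case: ifP; rewrite ?mule0 ?ltry.
Qed.

HB.instance Definition _ :=
  Measure_isSigmaFinite.Build _ _ _ lebesgue2 lebesgue2_sigma_finite.

End Lebesgue2.

(** * Rotation invariance of Lebesgue measure *)

Section Rotation.
Context {R : realType}.
Local Notation L := (@lebesgue_measure R).
Local Notation L2 := (@lebesgue2 R).
Local Notation plane := (measurableTypeR R * measurableTypeR R)%type.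
Implicit Types (S : set plane) (Q : set (space3 R)).

Definition rot (a b : R) (p : plane) : plane :=
  (a * p.1 - b * p.2, b * p.1 + a * p.2).

Lemma lebesgue2_shear_fst (k : R) S : measurable S ->
  L2 [set p | S (p.1 + k * p.2, p.2)] = L2 S.
Proof.
move=> mS; apply: (product_measure_preimage_fst L L (fun y x => x + k * y)) => //.
  by apply: measurable_funD => //; exact: measurable_funM.
by move=> y A mA; exact: (lebesgue_measure_translation (k * y)).
Qed.

Lemma lebesgue2_shear_snd (k : R) S : measurable S ->
  L2 [set p | S (p.1, p.2 + k * p.1)] = L2 S.
Proof.
move=> mS; apply: (product_measure_preimage_snd L L (fun x y => y + k * x)) => //.
by move=> x A mA; exact: (lebesgue_measure_translation (k * x)).
Qed.

(* A rotation is a product of three shears, and a shear preserves the volume by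
   translation invariance on the lines that it slides. *)
Lemma rot_shears (a b : R) : a ^+ 2 + b ^+ 2 = 1 -> b != 0 ->
  forall x y : R, let k := (a - 1) / b in
  let x' := x + k * y in let y' := y + b * x' in
  (x' + k * y', y') = rot a b (x, y).
Proof.
move=> ab b0 x y /=; rewrite /rot /=; congr pair; last by field.
apply/eqP; rewrite -subr_eq0; apply/eqP.
rewrite (_ : _ - _ = (a ^+ 2 + b ^+ 2 - 1) * y / b); last by field.
by rewrite ab subrr !mul0r.
Qed.

Lemma rot1 p : rot 1 0 p = p.
Proof. by case: p => x y; rewrite /rot /=; congr pair; ring. Qed.

(** The shear parameter [(a - 1) / b] degenerates at [b = 0]. The sign condition on [a], kept for
    all rotations below, excludes the half-turn there and leaves only the identity. *)
Lemma unit_nneg_b0 (a b : R) : a ^+ 2 + b ^+ 2 = 1 -> 0 <= a -> b = 0 -> a = 1.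
Proof. by move=> + a0 b0; rewrite b0 => h; nra. Qed.

Lemma measurable_shear_fst (k : R) :
  measurable_fun [set: plane] (fun p : plane => (p.1 + k * p.2, p.2) : plane).
Proof.
by apply: measurable_fun_pair => //; apply: measurable_funD => //; exact: measurable_funM.
Qed.

Lemma measurable_shear_snd (k : R) :
  measurable_fun [set: plane] (fun p : plane => (p.1, p.2 + k * p.1) : plane).
Proof.
by apply: measurable_fun_pair => //; apply: measurable_funD => //; exact: measurable_funM.
Qed.

Lemma lebesgue2_rot (a b : R) S : a ^+ 2 + b ^+ 2 = 1 -> 0 <= a ->
  measurable S -> L2 [set p | S (rot a b p)] = L2 S.
Proof.
move=> ab a0 mS; have [b0|b0] := eqVneq b 0.
  rewrite (unit_nneg_b0 ab a0 b0) b0; congr (L2 _).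
  by apply/seteqP; split => p /=; rewrite rot1.
pose k := (a - 1) / b.
have mS1 := measurable_preim (measurable_shear_fst k) mS.
have mS2 := measurable_preim (measurable_shear_snd b) mS1.
apply: etrans (etrans (lebesgue2_shear_fst k mS2)
  (etrans (lebesgue2_shear_snd b mS1) (lebesgue2_shear_fst k mS))).
congr (L2 _).
by apply/seteqP; split => -[x y] /=; rewrite -(rot_shears ab b0).
Qed.

Lemma measurable_x1 : measurable_fun setT (fun x : space3 R => x.1.1).
Proof. exact: (measurableT_comp measurable_fst measurable_fst). Qed.

Lemma measurable_x2 : measurable_fun setT (fun x : space3 R => x.1.2).
Proof. exact: (measurableT_comp measurable_snd measurable_fst). Qed.

Lemma measurable_rot (a b : R) : measurable_fun setT (rot a b).
Proof.
apply: measurable_fun_pair; [apply: measurable_funB|apply: measurable_funD];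
  exact: measurable_funM.
Qed.

Lemma lebesgue3E Q : lebesgue3 Q = (L2 \x L)%E Q.
Proof. by []. Qed.

Lemma lebesgue3_rot12 (a b : R) Q : a ^+ 2 + b ^+ 2 = 1 -> 0 <= a ->
  measurable Q -> lebesgue3 [set p | Q (rot a b p.1, p.2)] = lebesgue3 Q.
Proof.
move=> ab a0 mQ; rewrite !lebesgue3E.
apply: (product_measure_preimage_fst L2 L (fun=> rot a b)) => //.
  exact: (measurableT_comp (measurable_rot a b) measurable_fst).
by move=> _ A mA; exact: lebesgue2_rot.
Qed.

Lemma lebesgue3_shear_z (k : R) Q : measurable Q ->
  lebesgue3 [set p | Q (p.1, p.2 + k * p.1.2)] = lebesgue3 Q.
Proof.
move=> mQ; rewrite !lebesgue3E; apply: (product_measure_preimage_snd L2 L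
  (fun (p : plane) z => z + k * p.2)) => //.
by move=> x A mA; exact: (lebesgue_measure_translation (k * x.2)).
Qed.

Lemma lebesgue3_shear_y (k : R) Q : measurable Q ->
  lebesgue3 [set p | Q ((p.1.1, p.1.2 + k * p.2), p.2)] = lebesgue3 Q.
Proof.
move=> mQ; rewrite !lebesgue3E; apply: (product_measure_preimage_fst L2 L
  (fun (z : measurableTypeR R) (p : plane) => (p.1, p.2 + k * z) : plane)) => //.
  apply: measurable_fun_pair; first exact: measurable_x1.
  by apply: measurable_funD; [exact: measurable_x2|exact: measurable_funM].
move=> z A mA; apply: (product_measure_preimage_snd L L
  (fun (_ : measurableTypeR R) y => y + k * z)) => //.
by move=> x B mB; exact: (lebesgue_measure_translation (k * z)).
Qed.

Lemma measurable_shear_y (k : R) : measurable_fun [set: space3 R]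
  (fun p : space3 R => ((p.1.1, p.1.2 + k * p.2), p.2) : space3 R).
Proof.
apply: measurable_fun_pair => //; apply: measurable_fun_pair.
  exact: measurable_x1.
by apply: measurable_funD; [exact: measurable_x2|exact: measurable_funM].
Qed.

Lemma measurable_shear_z (k : R) : measurable_fun [set: space3 R]
  (fun p : space3 R => (p.1, p.2 + k * p.1.2) : space3 R).
Proof.
apply: measurable_fun_pair => //; apply: measurable_funD => //.
by apply: measurable_funM => //; exact: measurable_x2.
Qed.

(** The last two coordinates straddle the grouping [((x, y), z)] of the product measure, so this
    rotation is not fibrewise. The factorisation into three shears is carried out in space
    instead. *)
Lemma lebesgue3_rot23 (a b : R) Q : a ^+ 2 + b ^+ 2 = 1 -> 0 <= a ->
  measurable Q ->
  lebesgue3 [set p | Q ((p.1.1, (rot a b (p.1.2, p.2)).1),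
                        (rot a b (p.1.2, p.2)).2)] = lebesgue3 Q.
Proof.
move=> ab a0 mQ; have [b0|b0] := eqVneq b 0.
  rewrite (unit_nneg_b0 ab a0 b0) b0; congr (lebesgue3 _).
  by apply/seteqP; split => -[[x y] z] /=; rewrite !(mul1r, mul0r, subr0, add0r).
pose k := (a - 1) / b.
have mQ1 := measurable_preim (measurable_shear_y k) mQ.
have mQ2 := measurable_preim (measurable_shear_z b) mQ1.
apply: etrans (etrans (lebesgue3_shear_y k mQ2)
  (etrans (lebesgue3_shear_z b mQ1) (lebesgue3_shear_y k mQ))).
congr (lebesgue3 _).
by apply/seteqP; split => -[[x y] z] /=; case: (rot_shears ab b0 y z) => /= -> ->.
Qed.

Lemma measurable_dotr (u : space3 R) : measurable_fun setT (dot u).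
Proof.
apply: measurable_funD; last by apply: measurable_funM.
by apply: measurable_funD; apply: measurable_funM => //;
  [exact: measurable_x1|exact: measurable_x2].
Qed.

Section DotLaw.
Variable E : set plane.
Hypothesis mE : measurable E.

(** The joint law of the height along [u] and of the squared norm. A rotation preserves the norm and
    moves to [u] by adjunction, so [F] is constant along the coordinate rotations of [u]. *)
Let F (u : space3 R) := lebesgue3 [set x | E (dot u x, dot x x)].

Let mF u : measurable [set x : space3 R | E (dot u x, dot x x)].
Proof.
apply: (measurable_preim (f := fun x : space3 R => (dot u x, dot x x) : plane)) => //.
by apply: measurable_fun_pair; [exact: measurable_dotr|exact: measurable_dotxx].
Qed.

Let F12 (a b u1 u2 u3 : R) : a ^+ 2 + b ^+ 2 = 1 -> 0 <= a ->
  F ((u1, u2), u3) = F ((a * u1 + b * u2, a * u2 - b * u1), u3).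
Proof.
move=> ab a0; apply: etrans (esym (lebesgue3_rot12 ab a0 (mF _))) _.
congr (lebesgue3 _).
have e x : dot (u1, u2, u3) (rot a b x.1, x.2) =
    dot (a * u1 + b * u2, a * u2 - b * u1, u3) x :> R.
  by rewrite /dot/rot/=; ring.
have e' x : dot (rot a b x.1, x.2) (rot a b x.1, x.2) = dot x x :> R.
  rewrite /dot/rot/=; transitivity ((a ^+ 2 + b ^+ 2) * (x.1.1 ^+ 2 + x.1.2 ^+ 2)
    + x.2 ^+ 2); first by ring.
  by rewrite ab; ring.
by apply/seteqP; split => x /=; rewrite e e'.
Qed.

Let F23 (a b u1 u2 u3 : R) : a ^+ 2 + b ^+ 2 = 1 -> 0 <= a ->
  F ((u1, u2), u3) = F ((u1, a * u2 + b * u3), a * u3 - b * u2).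
Proof.
move=> ab a0; apply: etrans (esym (lebesgue3_rot23 ab a0 (mF _))) _.
congr (lebesgue3 _).
pose g (x : space3 R) : space3 R :=
  ((x.1.1, (rot a b (x.1.2, x.2)).1), (rot a b (x.1.2, x.2)).2).
have e x : dot (u1, u2, u3) (g x) =
    dot (u1, a * u2 + b * u3, a * u3 - b * u2) x :> R.
  by rewrite /dot/g/rot/=; ring.
have e' x : dot (g x) (g x) = dot x x :> R.
  rewrite /dot/g/rot/=; transitivity ((a ^+ 2 + b ^+ 2) * (x.1.2 ^+ 2 + x.2 ^+ 2)
    + x.1.1 ^+ 2); first by ring.
  by rewrite ab; ring.
by apply/seteqP; split => x /=; rewrite -/(g x) e e'.
Qed.

Lemma exists_turn (u v : R) : exists a b : R,
  [/\ a ^+ 2 + b ^+ 2 = 1, 0 <= a & a * u + b * v = 0].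
Proof.
have [->|v0] := eqVneq v 0; first by exists 0, 1; split => //; ring.
pose h := Num.sqrt (u ^+ 2 + v ^+ 2).
have uv0 : 0 < u ^+ 2 + v ^+ 2 by rewrite ltr_wpDl ?sqr_ge0// exprn_even_gt0.
have h2 : h ^+ 2 = u ^+ 2 + v ^+ 2 by rewrite sqr_sqrtr// ltW.
have h0 : 0 < h by rewrite sqrtr_gt0.
(* The unit vector [(v, - u) / h] is orthogonal to [(u, v)]; the sign of [v] makes its first entry
   nonnegative. *)
exists (`|v| / h), (- (Num.sg v * u) / h); split.
- rewrite !expr_div_n real_normK ?num_real// sqrrN exprMn sqr_sg v0 mul1r.
  by rewrite -mulrDl h2 addrC divff// gt_eqF.
- by rewrite divr_ge0// ltW.
- by rewrite normrEsg; field; rewrite gt_eqF.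
Qed.

(** A turn in the first two coordinates annihilates the first entry of [u], a turn in the last two
    annihilates the second, and a pole remains. *)
Lemma lebesgue3_dot_law (u : space3 R) : dot u u = 1 ->
  lebesgue3 [set x | E (dot u x, dot x x)] =
  lebesgue3 [set x | E (x.2, dot x x)].
Proof.
have -> : [set x : space3 R | E (x.2, dot x x)] =
          [set x : space3 R | E (dot ((0, 0), 1) x, dot x x)].
  have e x : dot ((0, 0), 1) x = x.2 :> R by rewrite /dot/=; ring.
  by apply/seteqP; split => x /=; rewrite e.
rewrite -/(F u) -/(F ((0, 0), 1)).
case: u => -[u1 u2] u3; rewrite /dot /= => u1E.
have [a [b [ab a0 e1]]] := exists_turn u1 u2.
rewrite (F12 u1 u2 u3 ab a0) e1.
have {e1} e2 : (a * u2 - b * u1) ^+ 2 = u1 ^+ 2 + u2 ^+ 2.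
  transitivity ((a ^+ 2 + b ^+ 2) * (u1 ^+ 2 + u2 ^+ 2) -
    (a * u1 + b * u2) ^+ 2); first by ring.
  by rewrite ab e1; ring.
set h := _ - _ in e2 *.
have [c [d [cd c0 e3]]] := exists_turn h u3.
rewrite (F23 _ h u3 cd c0) e3.
have {e3} e4 : (c * u3 - d * h) ^+ 2 = 1.
  transitivity ((c ^+ 2 + d ^+ 2) * (h ^+ 2 + u3 ^+ 2) -
    (c * h + d * u3) ^+ 2); first by ring.
  by rewrite cd e3 e2 !expr2 u1E; ring.
move/eqP: e4; rewrite sqrf_eq1 => /orP[/eqP->//|/eqP->].
(* The south pole is brought to the north pole by two quarter turns, since a half-turn would have a
   negative cosine. *)
have q : (0 : R) ^+ 2 + 1 ^+ 2 = 1 by ring.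
have half_turn (v w v' w' : R) : v' = w -> w' = - v ->
    F ((0, v), w) = F ((0, v'), w').
  move=> -> ->; apply: etrans (F23 0 v w q (lexx 0)) _.
  have -> : 0 * v + 1 * w = w by ring.
  by have -> : 0 * w - 1 * v = - v by ring.
apply: (@etrans _ _ (F ((0, -1), 0))); apply: half_turn => //; ring.
Qed.

End DotLaw.

End Rotation.

(** * Archimedes' theorem *)

Section Archimedes.
Context {R : realType}.
Local Notation L := (@lebesgue_measure R).
Local Notation L2 := (@lebesgue2 R).
Local Notation plane := (measurableTypeR R * measurableTypeR R)%type.
Implicit Types (S : set plane).
Local Open Scope ereal_scope.

Lemma measurable_dilate (k : R) :
  measurable_fun [set: plane] (fun p : plane => (k * p.1, k * p.2)%R : plane).
Proof. by apply: measurable_fun_pair; apply: measurable_funM. Qed.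

Lemma measurable_dilate_fst (k : R) :
  measurable_fun [set: plane] (fun p : plane => (k * p.1, p.2)%R : plane).
Proof. by apply: measurable_fun_pair => //; apply: measurable_funM. Qed.

Lemma measurable_xset S x : measurable S -> measurable [set y | S (x, y)].
Proof.
move=> mS; rewrite (_ : [set y | S (x, y)] = xsection S x).
  exact: measurable_xsection.
by apply/seteqP; split => y; rewrite /xsection /= inE.
Qed.

Lemma measurable_yset S y : measurable S -> measurable [set x | S (x, y)].
Proof.
move=> mS; rewrite (_ : [set x | S (x, y)] = ysection S y).
  exact: measurable_ysection.
by apply/seteqP; split => x; rewrite /ysection /= inE.
Qed.

Lemma lebesgue2X (A B : set (measurableTypeR R)) :
  measurable A -> measurable B -> L2 (A `*` B) = L A * L B.
Proof. exact: product_measure1E. Qed.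

Lemma lebesgue2_xsection S : L2 S = \int[L]_x L [set y | S (x, y)].
Proof. exact: (@product_measure_xsection _ _ _ _ R L L S). Qed.

Lemma lebesgue2_ysection S : measurable S ->
  L2 S = \int[L]_y L [set x | S (x, y)].
Proof. exact: (@product_measure_ysection _ _ _ _ R L L S). Qed.

Lemma measurable_fun_xset S : measurable S ->
  measurable_fun setT (fun x => L [set y | S (x, y)]).
Proof.
move=> mS; rewrite (_ : (fun _ => _) = L \o xsection S).
  exact: measurable_fun_xsection.
apply/funext => x /=; congr (L _).
by apply/seteqP; split => y; rewrite /xsection /= inE.
Qed.

Lemma measurable_fun_yset S : measurable S ->
  measurable_fun setT (fun y => L [set x | S (x, y)]).
Proof.
move=> mS; rewrite (_ : (fun _ => _) = L \o ysection S).
  exact: measurable_fun_ysection.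
apply/funext => y /=; congr (L _).
by apply/seteqP; split => x; rewrite /ysection /= inE.
Qed.

Lemma lebesgue2_dilation (k : R) S : (0 < k)%R -> measurable S ->
  (k ^+ 2)%:E * L2 [set p | S (k * p.1, k * p.2)%R] = L2 S.
Proof.
move=> k0 mS; have kE : 0 <= k%:E by rewrite lee_fin ltW.
have mS1 := measurable_preim (measurable_dilate_fst k) mS.
have mS2 := measurable_preim (measurable_dilate k) mS.
rewrite expr2 EFinM -muleA [L2 S]lebesgue2_ysection//.
rewrite lebesgue2_xsection -ge0_integralZl//; last exact: measurable_fun_xset.
transitivity (k%:E * L2 [set p | S (k * p.1, p.2)%R]).
  congr (_ * _); rewrite lebesgue2_xsection; apply: eq_integral => x _.
  exact: (lebesgue_measure_dilation k0 (measurable_xset (k * x)%R mS)).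
rewrite lebesgue2_ysection// -ge0_integralZl//; last exact: measurable_fun_yset.
apply: eq_integral => y _.
exact: (lebesgue_measure_dilation k0 (measurable_yset y mS)).
Qed.

Definition sqnorm2 (p : plane) : measurableTypeR R := (p.1 ^+ 2 + p.2 ^+ 2)%R.

Lemma measurable_sqnorm2 : measurable_fun setT sqnorm2.
Proof. by apply: measurable_funD; apply: measurable_funX. Qed.

(** The number pi, kept symbolic: it is a common factor of the volumes of cones and of the ball. *)
Definition disc_area : \bar R := L2 [set p | sqnorm2 p <= 1]%R.

Lemma measurable_disc (s : R) : measurable [set p | sqnorm2 p <= s]%R.
Proof.
rewrite (_ : [set _ | _] = sqnorm2 @^-1` `]-oo, s]%classic).
  by apply: (measurable_preim measurable_sqnorm2); exact: measurable_itv.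
by apply/seteqP; split => p /=; rewrite in_itv.
Qed.

Lemma disc_area_lty : disc_area < +oo.
Proof.
pose I : set (measurableTypeR R) := `[(-1)%R, 1%R]%classic.
have mI : measurable I by exact: measurable_itv.
apply: (@le_lt_trans _ _ (L2 (I `*` I))).
  apply: le_measure; rewrite ?inE; [exact: measurable_disc|exact: measurableX|].
  move=> [x y]; rewrite /sqnorm2/I/= !in_itv/= => xy1.
  by split; apply/andP; split; nra.
by rewrite lebesgue2X// /I lebesgue_measure_itv /=; case: ifP; rewrite ?mule0 ?ltry.
Qed.

Lemma disc_area_fin_num : disc_area \is a fin_num.
Proof. by rewrite ge0_fin_numE ?measure_ge0// disc_area_lty. Qed.

Lemma disc_area_scale (s : R) : (0 <= s)%R ->
  L2 [set p | sqnorm2 p <= s]%R = s%:E * disc_area.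
Proof.
rewrite le_eqVlt => /predU1P[<-|s0].
  have -> : [set p | sqnorm2 p <= 0]%R = [set 0%R] `*` [set 0%R].
    apply/seteqP; split => -[x y]; rewrite /sqnorm2 /=.
      by move=> xy; split => /=; nra.
    by move=> [-> ->] /=; rewrite expr0n /= addr0.
  rewrite mul0e lebesgue2X; [|exact: measurable_set1..].
  by rewrite lebesgue_measure_set1 mule0.
rewrite -(lebesgue2_dilation (k := Num.sqrt s)) ?sqrtr_gt0//; last first.
  exact: measurable_disc.
rewrite sqr_sqrtr ?ltW//; congr (_ * L2 _).
have e p : sqnorm2 (Num.sqrt s * p.1, Num.sqrt s * p.2)%R = (s * sqnorm2 p)%R.
  by rewrite /sqnorm2 /= !exprMn sqr_sqrtr ?ltW// mulrDr.
by apply/seteqP; split => p; rewrite /= e mulrC -ler_pdivlMr// divff// gt_eqF.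
Qed.

Lemma sqnorm2_ge0 p : (0 <= sqnorm2 p)%R.
Proof. by rewrite addr_ge0// sqr_ge0. Qed.

(** The set of [q] is cut at 0 so that the formula holds for all real [a] and [b], as a comparison
    of measures on half-open intervals requires. *)
Lemma annulus_area (a b : R) :
  L2 [set p | a < sqnorm2 p <= b]%R =
  disc_area * L [set q : measurableTypeR R | 0 <= q /\ a < q <= b]%R.
Proof.
set S := (X in L2 X); set Q := (X in L X).
have [ba|ab] := leP b a.
  have -> : S = set0 by apply/seteqP; split => // x /= /andP[? ?]; lra.
  have -> : Q = set0 by apply/seteqP; split => // x /= [_ /andP[? ?]]; lra.
  by rewrite !measure0 mule0.
have [b0|b0] := ltP b 0%R.
  have -> : S = set0.
    apply/seteqP; split => // x /= /andP[? ?].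
    by have := sqnorm2_ge0 x; lra.
  have -> : Q = set0 by apply/seteqP; split => // x /= [? /andP[? ?]]; lra.
  by rewrite !measure0 mule0.
have [a0|a0] := ltP a 0%R.
  rewrite (_ : S = [set p | sqnorm2 p <= b]%R); last first.
    apply/seteqP; split => p; rewrite /S /=; first by case/andP.
    by move=> ->; rewrite (lt_le_trans a0)// sqnorm2_ge0.
  rewrite (_ : Q = `[0%R, b]%classic); last first.
    apply/seteqP; split => q; rewrite /Q /= in_itv /=.
      by move=> [-> /andP[_ ->]].
    by move=> /andP[q0 ->]; rewrite q0 (lt_le_trans a0).
  rewrite disc_area_scale// muleC lebesgue_measure_itv /= lte_fin.
  by case: ltgtP b0 => // [b0|<-]; rewrite ?oppr0 ?adde0 ?mule0.
rewrite (_ : S =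
    [set p | sqnorm2 p <= b]%R `\` [set p | sqnorm2 p <= a]%R); last first.
  apply/seteqP; split => p; rewrite /S /=.
    by move=> /andP[ap pb]; split => //; apply/negP; rewrite -ltNge.
  by move=> [-> /negP]; rewrite -ltNge => ->.
rewrite (_ : Q = `]a, b]%classic); last first.
  apply/seteqP; split => q; rewrite /Q /= in_itv /=; first by case.
  by move=> h; split => //; case/andP: h => ? _; lra.
rewrite measureD//=; [|exact: measurable_disc|exact: measurable_disc|
    by rewrite disc_area_scale// lte_mul_pinfty// disc_area_lty].
rewrite setIidr; last by move=> p /= pa; apply: (le_trans pa); exact: ltW.
rewrite !disc_area_scale// lebesgue_measure_itv /= lte_fin ab.
rewrite muleC [a%:E * _]muleC -muleBr//.
exact: disc_area_fin_num.
Qed.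

(** The area of a disc is proportional to its squared radius, so the squared norm has constant
    density on the half-line. The two measures agree on half-open intervals by [annulus_area], which
    determines them. *)
Lemma lebesgue2_sqnorm2 (A : set (measurableTypeR R)) : measurable A ->
  L2 [set p | A (sqnorm2 p)] =
  disc_area * L [set q : measurableTypeR R | (0 <= q)%R /\ A q].
Proof.
move=> mA.
pose P : set (measurableTypeR R) := `[0%R, +oo[%classic.
have mP : measurable P by exact: measurable_itv.
pose f : {mfun plane >-> measurableTypeR R} :=
  HB.pack sqnorm2 (isMeasurableFun.Build _ _ _ _ _ measurable_sqnorm2).
have k0 : (0 <= fine disc_area)%R by exact/fine_ge0/measure_ge0.
have kE : (fine disc_area)%:E = disc_area by rewrite fineK ?disc_area_fin_num.
have PE B : L [set q : measurableTypeR R | (0 <= q)%R /\ B q] = L (B `&` P).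
  by congr (L _); apply/seteqP; split => q; rewrite /P /= in_itv /= andbT => -[].
rewrite PE -kE.
suff : pushforward L2 f A = mscale (NngNum k0) (mrestr L mP) A by [].
apply: (@measure_unique _ R (measurableTypeR R) (@ocitv R)
  (fun n : nat => `](- n%:R)%R, (n%:R : R)]%classic) _ _ _ _
  (pushforward L2 f) (mscale (NngNum k0) (mrestr L mP))) => //.
- exact: ocitvI.
- by move=> n; exact: is_ocitv.
- apply/seteqP; split => // x _; exists (Num.truncn `|x|).+1 => //=.
  rewrite in_itv /=; have := truncnS_gt `|x|.
  by rewrite ltr_norml => /andP[-> /ltW ->].
- move=> _ [[a b] _ <-].
  apply: etrans (annulus_area a b) _.
  by rewrite -[in LHS]kE PE.
- move=> n; suff : L2 [set p | - n%:R < sqnorm2 p <= n%:R]%R < +oo by [].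
  rewrite annulus_area lte_mul_pinfty ?measure_ge0 ?disc_area_fin_num//.
  apply: (@le_lt_trans _ _ (L `[0%R, n%:R]%classic)).
    apply: le_measure; rewrite ?inE; [|exact: measurable_itv|].
      rewrite (_ : [set _ | _] = `[0%R, +oo[%classic `&` `](- n%:R)%R, n%:R]%classic).
        by apply: measurableI; exact: measurable_itv.
      by apply/seteqP; split => q; rewrite /= !in_itv /= andbT.
    by move=> q; rewrite /= in_itv /= => -[-> /andP[_ ->]].
  by rewrite lebesgue_measure_itv; case: ifP; rewrite ?ltry.
Qed.

End Archimedes.

(** * The measure of a cap *)

Section CapMeasure.
Context {R : realType}.
Local Notation L := (@lebesgue_measure R).
Local Notation L2 := (@lebesgue2 R).
Local Notation plane := (measurableTypeR R * measurableTypeR R)%type.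
Local Notation E3 := (space3 R).
Local Open Scope ereal_scope.

Lemma measurable_le_sets d (T : measurableType d) (f g : T -> R) :
  measurable_fun setT f -> measurable_fun setT g ->
  measurable [set x | f x <= g x]%R.
Proof.
move=> mf mg; have m1 : measurable [set true] by [].
exact: measurable_preim (measurable_fun_ler mf mg) m1.
Qed.

Lemma measurable_lt_sets d (T : measurableType d) (f g : T -> R) :
  measurable_fun setT f -> measurable_fun setT g ->
  measurable [set x | f x < g x]%R.
Proof.
move=> mf mg; have m1 : measurable [set true] by [].
exact: measurable_preim (measurable_fun_ltr mf mg) m1.
Qed.

(* Archimedes: by the shear (z, q) -> (z, q + z ^ 2), q = |x| ^ 2 - z ^ 2, the volume of a set that
   only depends on z and on w = |x| ^ 2 is an area in the (z, w) plane. *)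
Lemma lebesgue3_height_sqnorm (E : set plane) : measurable E ->
  lebesgue3 [set x : E3 | E (x.2, dot x x)] =
  disc_area * L2 [set p : plane | (p.1 ^+ 2 <= p.2)%R /\ E p].
Proof.
move=> mE; have mF : measurable [set x : E3 | E (x.2, dot x x)].
  apply: (measurable_preim (f := fun x : E3 => (x.2, dot x x) : plane)) => //.
  by apply: measurable_fun_pair => //; exact: measurable_dotxx.
have mG : measurable [set p : plane | (p.1 ^+ 2 <= p.2)%R /\ E p].
  apply: measurableI => //; apply: measurable_le_sets => //.
  exact: measurable_funX.
rewrite lebesgue3E (product_measure_ysection L2 L mF) lebesgue2_xsection.
rewrite -ge0_integralZl ?measure_ge0//; last exact: measurable_fun_xset.
apply: eq_integral => z _.
have mA : measurable [set q : measurableTypeR R | E (z, q + z ^+ 2)%R].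
  apply: (measurable_preim
    (f := fun q : measurableTypeR R => (z, q + z ^+ 2)%R : plane)) => //.
  by apply: measurable_fun_pair => //; exact: measurable_funD.
have e p : dot (p, z) (p, z) = (sqnorm2 p + z ^+ 2)%R :> R.
  by rewrite /dot /sqnorm2 /= !expr2.
apply: etrans (etrans _ (lebesgue2_sqnorm2 mA)) _.
  by congr (L2 _); apply/seteqP; split => p /=; rewrite e.
congr (_ * _).
rewrite -(lebesgue_measure_translation (z ^+ 2) (measurable_xset z mG)).
congr (L _); apply/seteqP; split => q /=.
  by move=> [q0 Eq]; split => //; rewrite lerDr.
by move=> [q0 Eq]; split => //; move: q0; rewrite lerDr.
Qed.

Lemma measurable_sqrt_comp d (T : measurableType d) (f : T -> R) :
  measurable_fun setT f -> measurable_fun setT (fun x => Num.sqrt (f x)).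
Proof.
move=> mf; apply: measurableT_comp mf.
by apply: continuous_measurable_fun; exact: sqrt_continuous.
Qed.

(** Its value 2/3 cancels like pi; that it is finite is deduced from the finite volume of the
    ball. *)
Definition sqrt_mass : \bar R := \int[L]_(w in `]0%R, 1%R]) (Num.sqrt w)%:E.

(** In the coordinates height and squared norm, the solid cone over the cap of heights above [t],
    without its apex. *)
Definition cone (t : R) : set plane :=
  [set p : plane | (0 < p.2 <= 1 /\ t * Num.sqrt p.2 < p.1)%R].

Lemma measurable_cone (t : R) : measurable (cone t).
Proof.
rewrite (_ : cone t = [set p : plane | 0 < p.2]%R `&` [set p : plane | p.2 <= 1]%R `&`
   [set p : plane | t * Num.sqrt p.2 < p.1]%R); last first.
  apply/seteqP; split => p /=; first by move=> [/andP[]].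
  by move=> [[? ?] ?]; split => //; apply/andP.
apply: measurableI; first apply: measurableI.
- exact: measurable_lt_sets.
- exact: measurable_le_sets.
- apply: measurable_lt_sets => //; apply: measurable_funM => //.
  exact: measurable_sqrt_comp.
Qed.

Lemma integral_sqrt_scale (c : R) (f : R -> \bar R) : (0 <= c)%R ->
  (forall w, (0 < w <= 1)%R -> f w = (c * Num.sqrt w)%:E) ->
  (forall w, ~~ (0 < w <= 1)%R -> f w = 0) ->
  \int[L]_w f w = c%:E * sqrt_mass.
Proof.
move=> c0 f1 f2.
rewrite /sqrt_mass -ge0_integralZl//; last first.
  apply/measurable_funTS/measurable_EFinP.
  by apply: continuous_measurable_fun; exact: sqrt_continuous.
rewrite [RHS]integral_mkcond; apply: eq_integral => w _.
rewrite patchE; case: ifPn => [|wN].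
  by rewrite inE /= in_itv /= => w01; rewrite f1.
by rewrite f2//; apply: contra wN => w01; rewrite inE /= in_itv.
Qed.

(** At squared norm w the heights fill the interval from [t * sqrt w] to [sqrt w]. That its length
    is affine in [t] is Archimedes' hat-box theorem. *)
Lemma lebesgue2_cone (t : R) : (-1 <= t <= 1)%R ->
  L2 [set p : plane | (p.1 ^+ 2 <= p.2)%R /\ cone t p] = (1 - t)%:E * sqrt_mass.
Proof.
move=> t1; rewrite lebesgue2_ysection; last first.
  apply: measurableI; last exact: measurable_cone.
  by apply: measurable_le_sets => //; exact: measurable_funX.
apply: integral_sqrt_scale => [|w w01|w w01]; first by lra.
- have -> : [set z | ((z, w).1 ^+ 2 <= (z, w).2)%R /\ cone t (z, w)] =
      `](t * Num.sqrt w)%R, Num.sqrt w]%classic.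
    have s0 : (0 <= Num.sqrt w)%R by rewrite sqrtr_ge0.
    have s2 : (Num.sqrt w ^+ 2 = w)%R by rewrite sqr_sqrtr//; lra.
    apply/seteqP; split => z; rewrite /cone /= in_itv /=.
      by move=> [zw [_ ->]] /=; rewrite -s2 in zw; nra.
    move=> /andP[z1 z2]; split; last by split.
    have z3 : (- Num.sqrt w <= z)%R by move: t1 => /andP[t1 _]; nra.
    by rewrite -[leRHS]s2; nra.
  rewrite lebesgue_measure_itv /= lte_fin; case: ltP => h.
    by rewrite -EFinB; congr (_ %:E); ring.
  congr (_ %:E); have := sqrtr_ge0 w => s0.
  have [t1'|t1'] := eqVneq t 1%R; first by rewrite t1'; ring.
  have lt1 : (t < 1)%R by rewrite lt_neqAle t1'; lra.
  have -> : Num.sqrt w = 0%R by nra.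
  by rewrite mulr0.
- have -> : [set z | ((z, w).1 ^+ 2 <= (z, w).2)%R /\ cone t (z, w)] = set0.
    by apply/seteqP; split => // z [_ [/= h _]]; rewrite h in w01.
  by rewrite measure0.
Qed.

Lemma unit_ballE : @unit_ball R = [set x | dot x x <= 1]%R.
Proof.
have e (x : E3) : (enorm x <= 1)%R = (dot x x <= 1)%R.
  by rewrite /enorm -{1}[1%R]sqrtr1 ler_sqrt.
by apply/seteqP; split => x; rewrite /unit_ball /= e.
Qed.

Lemma lebesgue3_unit_ballE :
  lebesgue3 (@unit_ball R) = disc_area * (2%:E * sqrt_mass).
Proof.
have mB : measurable [set p : plane | p.2 <= 1]%R by exact: measurable_le_sets.
rewrite unit_ballE (lebesgue3_height_sqnorm mB); congr (_ * _).
rewrite lebesgue2_ysection; last first.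
  by apply: measurableI => //; apply: measurable_le_sets => //; exact: measurable_funX.
apply: integral_sqrt_scale => // [w w01|w w01].
- have -> : [set z | ((z, w).1 ^+ 2 <= (z, w).2)%R /\ ((z, w).2 <= 1)%R] =
      `[(- Num.sqrt w)%R, Num.sqrt w]%classic.
    have s0 : (0 <= Num.sqrt w)%R by rewrite sqrtr_ge0.
    have s2 : (Num.sqrt w ^+ 2 = w)%R by rewrite sqr_sqrtr//; lra.
    apply/seteqP; split => z; rewrite /= in_itv /=.
      by move=> [zw _]; rewrite -s2 in zw; apply/andP; split; nra.
    by move=> /andP[z1 z2]; split; [rewrite -[leRHS]s2; nra|lra].
  have s0 : (0 < Num.sqrt w)%R by rewrite sqrtr_gt0; lra.
  rewrite lebesgue_measure_itv /= lte_fin ifT; last by lra.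
  by rewrite -EFinB; congr (_ %:E); ring.
- have [w0|w0] := ltP 0%R w.
    have -> : [set z | ((z, w).1 ^+ 2 <= (z, w).2)%R /\ ((z, w).2 <= 1)%R] = set0.
      by apply/seteqP; split => // z [_ /= h]; move: w01; rewrite w0 h.
    by rewrite measure0.
  apply/eqP; rewrite -measure_le0 -(@lebesgue_measure_set1 R 0%R).
  apply: le_measure; rewrite ?inE; [|exact: measurable_set1|].
    have mS : measurable [set p : plane | (p.1 ^+ 2 <= p.2)%R /\ (p.2 <= 1)%R].
      by apply: measurableI => //; apply: measurable_le_sets => //; exact: measurable_funX.
    exact: (measurable_yset w mS).
  by move=> z /= [zw _]; nra.
Qed.

Lemma radial_projE (u x : E3) : dot u (radial_proj x) = (dot u x / enorm x)%R.
Proof. by rewrite /dot /radial_proj /= !mulrDl !mulrA. Qed.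

Lemma dot_ge0 (x : E3) : (0 <= dot x x)%R.
Proof. by rewrite /dot -!expr2 !addr_ge0// sqr_ge0. Qed.

Lemma sphereE (x : E3) : sphere x <-> dot x x = 1%R.
Proof.
rewrite /sphere /enorm /=; split => [h|->]; last by rewrite sqrtr1.
by rewrite -[LHS]sqr_sqrtr ?dot_ge0// h expr1n.
Qed.

(** Division by zero returns 0, so the origin is projected to itself and misses the sphere; this is
    why [cone] omits its apex. *)
Lemma sphere_radial_proj (x : E3) : sphere (radial_proj x) <-> (0 < dot x x)%R.
Proof.
rewrite sphereE radial_projE /enorm.
have -> : dot (radial_proj x) x = (dot x x / enorm x)%R.
  by rewrite /dot /radial_proj /=; ring.
have [x0|x0] := leP (dot x x) 0%R.
  have -> : dot x x = 0%R by apply/eqP; rewrite eq_le x0 dot_ge0.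
  by rewrite !mul0r; split => // /esym/eqP; rewrite oner_eq0.
split => // _; rewrite -mulrA -invfM /enorm -expr2 sqr_sqrtr ?dot_ge0//.
by rewrite divff// gt_eqF.
Qed.

(** The axis [u] is moved to the vertical one, and the cone volume is divided by that of the ball,
    which carries the same factor [disc_area * sqrt_mass]. *)
Lemma sigma_cap (u : E3) (t : R) : sphere u -> (-1 <= t <= 1)%R ->
  sigma [set y | sphere y /\ (t < dot u y)%R] = ((1 - t) / 2)%:E.
Proof.
move=> /sphereE uu t1; rewrite sigmaE.
have -> : radial_proj @^-1` [set y | sphere y /\ (t < dot u y)%R] `&` unit_ball =
    [set x | cone t (dot u x, dot x x)].
  rewrite unit_ballE; apply/seteqP; split => x; rewrite /cone /=.
    move=> [[/sphere_radial_proj x0 +] x1]; rewrite radial_projE.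
    by rewrite ltr_pdivlMr ?sqrtr_gt0// x0 x1; split.
  move=> [/andP[x0 x1] h]; split => //; split; first exact/sphere_radial_proj.
  by rewrite radial_projE ltr_pdivlMr ?sqrtr_gt0.
rewrite (lebesgue3_dot_law (measurable_cone t) uu).
rewrite (lebesgue3_height_sqnorm (measurable_cone t)) lebesgue2_cone//.
have := @lebesgue3_unit_ball R; rewrite lebesgue3_unit_ballE.
have kE : (fine disc_area)%:E = @disc_area R by rewrite fineK ?disc_area_fin_num.
rewrite -kE; set k := fine _.
have : 0 <= sqrt_mass by apply: integral_ge0 => w _; rewrite lee_fin sqrtr_ge0.
(* The volume of the ball is positive and finite: this rules out an infinite [sqrt_mass] and, below,
   a vanishing factor. *)
case: sqrt_mass => [I|_|//]; last first.
  rewrite gt0_muley ?lte_fin//.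
  move=> /andP[]; case: (ltgtP 0%R k) => [k0|k0|<-].
  - by rewrite gt0_muley ?lte_fin.
  - by rewrite lt0_muley ?lte_fin.
  - by rewrite mul0e ltxx.
rewrite -!EFinM lee_fin lte_fin => I0 /andP[kI _].
rewrite inver gt_eqF// -EFinM; congr EFin; field.
by apply/andP; split; apply: contraTneq kI => ->; rewrite ?mulr0 ?mul0r ?ltxx.
Qed.

End CapMeasure.

(** * Product measures and marginals *)

Lemma integral_prob_cst d (T : measurableType d) (R : realType)
    (P : probability T R) (r : \bar R) : (\int[P]_x r = r)%E.
Proof.
by apply: etrans (integral_cst P measurableT r) _; rewrite [X in (_ * X)%E](probability_setT P) mule1.
Qed.

Lemma indic_comp (T1 T2 : Type) (R : pzRingType) (f : T1 -> T2) (A : set T2) x :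
  \1_[set y | A (f y)] x = \1_A (f x) :> R.
Proof.
by rewrite !indicE; congr (nat_of_bool _)%:R; apply/idP/idP => /set_mem h;
  exact/mem_set.
Qed.

Lemma integral_indicT d (T : measurableType d) (R : realType)
    (mu : {measure set T -> \bar R}) (A : set T) : measurable A ->
  (\int[mu]_x (\1_A x)%:E = mu A)%E.
Proof. by move=> mA; rewrite integral_indic// setIT. Qed.

Section PowerMeasure.
Context d (T : measurableType d) (R : realType) (P : probability T R).
Local Open Scope ereal_scope.

Lemma integral_powerPS n (f : n.+1.-tuple T -> \bar R) :
  measurable_fun setT f -> (forall x, 0 <= f x) ->
  \int[powerP P n.+1]_x f x =
  \int[P]_x \int[powerP P n]_y f (consp (x, y)).
Proof.
move=> mf f0; rewrite ge0_integral_distribution//.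
have mg : measurable_fun setT (f \o @consp _ T n).
  exact: measurableT_comp mf (@measurable_consp _ T n).
by apply: (fubini_tonelli1 (m1 := P) (m2 := powerP P n) (f \o @consp _ T n)) => //= x; exact: f0.
Qed.

Definition catp k m (xy : k.-tuple T * m.-tuple T) : (k + m).-tuple T :=
  [tuple of xy.1 ++ xy.2].

Lemma measurable_catp k m : measurable_fun setT (@catp k m).
Proof.
apply/measurable_fun_tnthP => i.
case: (split_ordP i) => j ->.
  rewrite (_ : _ \o _ = fun xy => tnth xy.1 j).
    exact: (measurableT_comp (measurable_tnth j) measurable_fst).
  by apply/funext => xy /=; rewrite /catp tnth_lshift.
rewrite (_ : _ \o _ = fun xy => tnth xy.2 j).
  exact: (measurableT_comp (measurable_tnth j) measurable_snd).
by apply/funext => xy /=; rewrite /catp tnth_rshift.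
Qed.

Lemma measurable_pair_l d1 d2 d3 (T1 : measurableType d1) (T2 : measurableType d2)
    (T3 : measurableType d3) (f : T1 * T2 -> T3) x :
  measurable_fun setT f -> measurable_fun setT (fun y => f (x, y)).
Proof. by move=> mf; exact: measurableT_comp mf (pair1_measurable x). Qed.

Lemma integral_powerP_cat k m (f : (k + m).-tuple T -> \bar R) :
  measurable_fun setT f -> (forall x, 0 <= f x) ->
  \int[powerP P (k + m)]_x f x =
  \int[powerP P k]_x \int[powerP P m]_y f (catp (x, y)).
Proof.
elim: k f => [|k IH] f mf f0.
  rewrite integral_dirac//=; last first.
    apply: (measurable_fun_fubini_tonelli_F (m2 := powerP P m)
      (f \o @catp 0 m)) => //; last by move=> ?; exact: f0.
    exact: measurableT_comp mf (@measurable_catp 0 m).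
  rewrite diracT mul1e; apply: eq_integral => y _; congr f.
  exact: val_inj.
have mg : measurable_fun setT (f \o @catp k.+1 m).
  exact: measurableT_comp mf (@measurable_catp k.+1 m).
rewrite [LHS]integral_powerPS// [RHS]integral_powerPS//; first last.
- by move=> x; apply: integral_ge0.
- apply: (measurable_fun_fubini_tonelli_F (m2 := powerP P m)
    (f \o @catp k.+1 m)) => // x; exact: f0.
apply: eq_integral => x _; rewrite (IH (fun z => f (consp (x, z))))//; last first.
  apply: (measurable_pair_l (f := f \o @consp _ T (k + m))).
  exact: measurableT_comp mf (@measurable_consp _ T (k + m)).
apply: eq_integral => xs _; apply: eq_integral => y _; congr f.
exact: val_inj.
Qed.

Lemma integral_powerP_tcast k m N (e : (k + m)%N = N) (f : N.-tuple T -> \bar R) :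
  measurable_fun setT f -> (forall x, 0 <= f x) ->
  \int[powerP P N]_x f x =
  \int[powerP P k]_x \int[powerP P m]_y f (tcast e (catp (x, y))).
Proof. by case: _ / e f => f mf f0; rewrite integral_powerP_cat. Qed.

Lemma measurable_tcast (k N : nat) (e : k = N) : measurable_fun setT (@tcast T k N e).
Proof. by case: _ / e; exact: measurable_id. Qed.

Lemma powerP_tnth n (i : 'I_n) (A : set T) : measurable A ->
  powerP P n [set x | A (tnth x i)] = P A.
Proof.
elim: n i => [[]//|n IH] i mA.
have mAi m (j : 'I_m) : measurable [set x : m.-tuple T | A (tnth x j)].
  exact: (measurable_preim (measurable_tnth j) mA).
apply: etrans (esym (integral_indicT _ (mAi _ i))) _.
apply: etrans (integral_powerPS _ _) _.
- apply/measurable_EFinP; apply: measurable_indic; exact: mAi.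
- by move=> x; rewrite lee_fin.
case: (unliftP ord0 i) => [j|] ->.
  transitivity (\int[P]_x P A).
    apply: eq_integral => x _; rewrite -(IH j mA) -[RHS]integral_indicT; last exact: mAi.
    apply: eq_integral => y _; rewrite (indic_comp _ (fun x => tnth x (lift ord0 j))).
    by rewrite (indic_comp _ (fun x => tnth x j)) /consp tnthS.
  exact: integral_prob_cst.
rewrite -[RHS]integral_indicT//; apply: eq_integral => x _.
transitivity (\int[powerP P n]_y (\1_A x)%:E).
  by apply: eq_integral => y _; rewrite (indic_comp _ (fun x => tnth x ord0)).
exact: integral_prob_cst.
Qed.

Lemma ae_powerP_tnth n (i : 'I_n) (A : set T) : measurable A -> P A = 1 ->
  {ae powerP P n, forall x, A (tnth x i)}.
Proof.
move=> mA PA; have mS := measurable_preim (measurable_tnth i) mA.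
exists (~` [set x | A (tnth x i)]); split => //; first exact: measurableC.
by rewrite probability_setC// powerP_tnth// PA subee.
Qed.

End PowerMeasure.

Section Marginals.
Context {R : realType} (N : nat) (X : point_process R N).
Local Notation E3 := (space3 R).
Local Open Scope ereal_scope.

Definition take_tuple k (kN : (k <= N)%N) (x : N.-tuple E3) : k.-tuple E3 :=
  [tuple tnth x (widen_ord kN i) | i < k].

Lemma measurable_take_tuple k (kN : (k <= N)%N) :
  measurable_fun setT (take_tuple kN).
Proof.
apply/measurable_fun_tnthP => i.
rewrite (_ : _ \o _ = fun x => tnth x (widen_ord kN i)).
  exact: measurable_tnth.
by apply/funext => x /=; rewrite /take_tuple tnth_mktuple.
Qed.

Lemma take_tuple_catp k (kN : (k <= N)%N) (x : k.-tuple E3) (y : (N - k).-tuple E3) :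
  take_tuple kN (tcast (subnKC kN) (catp (x, y))) = x.
Proof.
apply: eq_from_tnth => i; rewrite /take_tuple tnth_mktuple tcastE.
rewrite (_ : cast_ord _ _ = lshift (N - k) i); last exact: val_inj.
by rewrite /catp tnth_lshift.
Qed.

Lemma measurable_reduced_density k (kN : (k <= N)%N) :
  measurable_fun setT (reduced_density X kN).
Proof.
pose D (xy : k.-tuple E3 * (N - k).-tuple E3) :=
  (pp_density X (tcast (subnKC kN) (catp xy)))%:E.
have mD : measurable_fun setT D.
  apply/measurable_EFinP; apply: measurableT_comp => //.
  exact: measurableT_comp (measurable_tcast _) (@measurable_catp _ E3 k (N - k)).
apply: (measurableT_comp (@fine_measurable R _ measurableT)).
apply: (measurable_fun_fubini_tonelli_F (m2 := powerP sigma (N - k)) D) => // x.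
by rewrite lee_fin pp_density_ge0.
Qed.

(** Tonelli's theorem over the last [N - k] variables, since the event does not depend on them. *)
Lemma pp_marginal k (kN : (k <= N)%N) (B : set (k.-tuple E3)) : measurable B ->
  pp_prob X [set w | B (take_tuple kN (pp_points X w))] =
  \int[powerP sigma k]_(x in B) (reduced_density X kN x)%:E.
Proof.
move=> mB; have mpB := measurable_preim (measurable_take_tuple kN) mB.
pose D x := (pp_density X x)%:E.
have mD : measurable_fun setT D by apply/measurable_EFinP.
have D0 x : 0 <= D x by rewrite lee_fin pp_density_ge0.
pose e := subnKC kN.
have mDe : measurable_fun setT (fun xy : k.-tuple E3 * (N - k).-tuple E3 =>
    D (tcast e (catp xy))).
  apply: measurableT_comp mD _.
  exact: measurableT_comp (measurable_tcast e) (@measurable_catp _ E3 k (N - k)).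
pose I x := \int[powerP sigma (N - k)]_y D (tcast e (catp (x, y))).
have mI : measurable_fun setT I.
  apply: (measurable_fun_fubini_tonelli_F (m2 := powerP sigma (N - k))
    (fun xy => D (tcast e (catp xy)))) => //.
have I0 x : 0 <= I x by apply: integral_ge0.
have I1 : \int[powerP sigma k]_x I x = 1.
  rewrite /I -(integral_powerP_tcast sigma e)//.
  transitivity (distribution (pp_prob X) (pp_points X) setT).
    by rewrite pp_densityP.
  exact: probability_setT.
(* As a real-valued integral, [reduced_density] returns 0 where the inner integral is infinite. The
   total mass being 1, this only happens on a null set. *)
have Ifin : ae_eq (powerP sigma k) setT I (fun x => (reduced_density X kN x)%:E).
  have : (powerP sigma k).-integrable setT I.
    apply/integrableP; split => //.
    by under eq_integral do rewrite gee0_abs//; rewrite I1 ltry.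
  move=> /(integrable_ae measurableT); apply: filterS => x /= Ix _.
  by rewrite /reduced_density /Rintegral fineK//; exact: Ix.
transitivity (distribution (pp_prob X) (pp_points X) [set x | B (take_tuple kN x)]) => //.
rewrite pp_densityP// integral_mkcond [RHS]integral_mkcond !epatch_indic.
rewrite (integral_powerP_tcast sigma e); last 2 first.
- by apply: emeasurable_funM => //; apply/measurable_EFinP; exact: measurable_indic.
- by move=> x; rewrite mule_ge0 ?lee_fin ?pp_density_ge0.
transitivity (\int[powerP sigma k]_x (I x * (\1_B x)%:E)).
  apply: eq_integral => x _.
  transitivity (\int[powerP sigma (N - k)]_y
      (D (tcast e (catp (x, y))) * (\1_B x)%:E)).
    apply: eq_integral => y _; congr (_ * _).
    by rewrite /= (indic_comp _ (take_tuple kN)) take_tuple_catp.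
  rewrite ge0_integralZr ?lee_fin//.
  exact: (measurable_pair_l (f := fun xy => D (tcast e (catp xy)))).
have mind : measurable_fun setT (fun x : k.-tuple E3 => (\1_B x)%:E : \bar R).
  by apply/measurable_EFinP; exact: measurable_indic.
have mred : measurable_fun setT (fun x => (reduced_density X kN x)%:E).
  by apply/measurable_EFinP; exact: measurable_reduced_density.
apply: ge0_ae_eq_integral => //.
- exact: emeasurable_funM.
- exact: emeasurable_funM.
- by move=> x _; rewrite mule_ge0 ?lee_fin.
- move=> x _; rewrite mule_ge0 ?lee_fin//.
  by apply: Rintegral_ge0 => y _; exact: pp_density_ge0.
- by apply: filterS Ifin => x /= h _; rewrite h.
Qed.

Lemma pp_exchange (s : 'S_N) (B : set (N.-tuple E3)) : measurable B ->
  pp_prob X [set w | B [tuple tnth (pp_points X w) (s i) | i < N]] =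
  pp_prob X [set w | B (pp_points X w)].
Proof. by move=> mB; rewrite pp_exchangeable. Qed.

End Marginals.

(** * The spherical kernel *)

Lemma det_mx22 (F : comNzRingType) (A : 'M[F]_2) :
  \det A = A ord0 ord0 * A ord_max ord_max - A ord0 ord_max * A ord_max ord0.
Proof.
have e : lift ord0 (ord0 : 'I_1) = ord_max :> 'I_2 by apply: val_inj.
have e' : lift ord_max (ord0 : 'I_1) = ord0 :> 'I_2 by apply: val_inj.
rewrite (expand_det_row _ ord0) big_ord_recl big_ord1 /cofactor !det_mx11 !mxE.
by rewrite /= !e !e' expr0 mul1r expr1 mulN1r mulrN.
Qed.

Section Kernel.
Context {R : realType}.
Local Notation E3 := (space3 R).
Local Open Scope complex_scope.

Definition similarity (x y : E3) : R := (1 + dot x y) / 2.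

Lemma dotC (x y : E3) : dot x y = dot y x.
Proof. by rewrite /dot; ring. Qed.

Lemma sphere_dot (x : E3) : sphere x -> x.1.1 ^+ 2 + x.1.2 ^+ 2 + x.2 ^+ 2 = 1.
Proof. by move=> /sphereE; rewrite /dot -!expr2. Qed.

Lemma kernel_diag N (x : E3) : (0 < N)%N -> sphere x -> x.2 < 1 ->
  spherical_kernel N x x = (N%:R : R)%:C.
Proof.
move=> N0 /sphereE xx x1; rewrite /spherical_kernel xx.
have -> : Num.sqrt ((1 - x.2) * (1 - x.2)) = 1 - x.2.
  by rewrite -expr2 sqrtr_sqr ger0_norm// subr_ge0 ltW.
have -> : (1 + 1 - x.2 - x.2) +i* (x.1.2 * x.1.1 - x.1.1 * x.1.2) =
    2 * (1 - x.2)%:C.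
  rewrite (_ : 2 = (2 : R)%:C); last by rewrite rmorph_nat.
  by rewrite -rmorphM /=; congr Complex; ring.
rewrite mulfK; last by rewrite fmorph_eq0 subr_eq0 gt_eqF.
by rewrite divfK ?rmorph_nat// expf_neq0// pnatr_eq0.
Qed.

(** Lagrange's identity for the horizontal parts of x and y rewrites the squared imaginary part
    through their inner product [p] and the two heights; the rest is a polynomial identity in these
    three numbers. *)
Lemma kernel_sqnorm (x y : E3) : sphere x -> sphere y ->
  (1 + dot x y - x.2 - y.2) ^+ 2 + (x.1.2 * y.1.1 - x.1.1 * y.1.2) ^+ 2 =
  2 * (1 + dot x y) * ((1 - x.2) * (1 - y.2)).
Proof.
move=> /sphere_dot sx /sphere_dot sy.
set p := x.1.1 * y.1.1 + x.1.2 * y.1.2.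
have -> : (x.1.2 * y.1.1 - x.1.1 * y.1.2) ^+ 2 =
    (1 - x.2 ^+ 2) * (1 - y.2 ^+ 2) - p ^+ 2.
  have -> : 1 - x.2 ^+ 2 = x.1.1 ^+ 2 + x.1.2 ^+ 2 by rewrite -sx addrK.
  have -> : 1 - y.2 ^+ 2 = y.1.1 ^+ 2 + y.1.2 ^+ 2 by rewrite -sy addrK.
  by rewrite /p; ring.
by rewrite (_ : dot x y = p + x.2 * y.2)// /p; ring.
Qed.

(** Exchanging the arguments conjugates the kernel, so the product is a squared modulus: the phase
    and the singular denominator disappear from determinants of order 2. *)
Lemma kernel_mul N (x y : E3) : sphere x -> sphere y -> x.2 < 1 -> y.2 < 1 ->
  spherical_kernel N x y * spherical_kernel N y x =
  (N%:R ^+ 2 * similarity x y ^+ N.-1)%:C.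
Proof.
move=> sx sy x1 y1; rewrite /spherical_kernel mulrACA -exprMn.
rewrite [(1 - y.2) * _]mulrC; set k := _ / 2 ^+ _; rewrite [X in X ^+ _]mulf_div.
have -> : ((1 + dot x y - x.2 - y.2) +i* (x.1.2 * y.1.1 - x.1.1 * y.1.2)) *
    ((1 + dot y x - y.2 - x.2) +i* (y.1.2 * x.1.1 - y.1.1 * x.1.2)) =
    (2 * (1 + dot x y) * ((1 - x.2) * (1 - y.2)))%:C.
  rewrite -kernel_sqnorm// (dotC y x).
  apply/eqP; rewrite eq_complex /=; apply/andP; split; apply/eqP; ring.
have m0 : 0 < (1 - x.2) * (1 - y.2) by rewrite mulr_gt0// subr_gt0.
have -> : (Num.sqrt ((1 - x.2) * (1 - y.2)))%:C *
    (Num.sqrt ((1 - x.2) * (1 - y.2)))%:C = ((1 - x.2) * (1 - y.2))%:C.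
  by rewrite -rmorphM -expr2 /= sqr_sqrtr// ltW.
rewrite [X in X ^+ _]( _ : _ = (2 * (1 + dot x y))%:C); last first.
  by rewrite -fmorph_div /= mulfK// gt_eqF.
have -> : k * k = (N%:R ^+ 2 / 4 ^+ N.-1 : R)%:C.
  rewrite /k fmorph_div !rmorphXn !rmorph_nat /= mulf_div -expr2; congr (_ / _).
  by rewrite -exprMn -natrM.
rewrite -(rmorphXn (real_complex R)) -(rmorphM (real_complex R)) /=.
congr (_%:C).
rewrite /similarity -mulrA; congr (_ * _); rewrite mulrC -expr_div_n.
by congr (_ ^+ _); field.
Qed.

Lemma spherical_det1 N (x : 1.-tuple E3) : (0 < N)%N ->
  sphere (tnth x ord0) -> (tnth x ord0).2 < 1 ->
  ((N - 1)`!)%:R / (N`!)%:R *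
  \det (\matrix_(i < 1, j < 1) spherical_kernel N (tnth x i) (tnth x j)) = 1.
Proof.
case: N => // n _ sx x1; rewrite det_mx11 mxE kernel_diag// rmorph_nat.
rewrite subn1 factS natrM invfM mulrCA mulfV ?pnatr_eq0 -?lt0n ?fact_gt0//.
by rewrite mulr1 mulVf// pnatr_eq0.
Qed.

Lemma spherical_det2 N (x : 2.-tuple E3) : (1 < N)%N ->
  (forall i, sphere (tnth x i)) -> (forall i, (tnth x i).2 < 1) ->
  ((N - 2)`!)%:R / (N`!)%:R *
  \det (\matrix_(i < 2, j < 2) spherical_kernel N (tnth x i) (tnth x j)) =
  (N%:R / (N.-1)%:R *
    (1 - similarity (tnth x ord0) (tnth x ord_max) ^+ N.-1))%:C.
Proof.
move=> N1 sx x1; rewrite det_mx22 !mxE.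
rewrite !kernel_diag ?(ltnW N1)// kernel_mul// -rmorphM -rmorphB /=.
have -> : ((N - 2)`!)%:R / (N`!)%:R = (((N - 2)`!)%:R / (N`!)%:R : R)%:C.
  by rewrite fmorph_div !rmorph_nat.
rewrite -rmorphM /=; congr (_%:C).
case: N N1 {sx x1} => [//|[//|n]] _.
rewrite subn2 /= !factS !natrM.
have : (n`!)%:R != 0 :> R by rewrite pnatr_eq0 -lt0n fact_gt0.
have : n.+1%:R != 0 :> R by rewrite pnatr_eq0.
have : n.+2%:R != 0 :> R by rewrite pnatr_eq0.
move: (n.+2%:R : R) (n.+1%:R : R) (n`!%:R : R) => a b c a0 b0 c0.
by field; rewrite a0 b0 c0.
Qed.

End Kernel.

Lemma integral_powerP2 d (T : measurableType d) (R : realType)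
    (P : probability T R) (f : T * T -> \bar R) :
  measurable_fun setT f -> (forall p, (0 <= f p)%E) ->
  (\int[powerP P 2]_x f (tnth x ord0, tnth x ord_max) =
   \int[(P \x P)%E]_p f p)%E.
Proof.
move=> mf f0.
have mt n (i j : 'I_n) :
    measurable_fun setT (fun x : n.-tuple T => f (tnth x i, tnth x j)).
  apply: measurableT_comp => //.
  by apply: measurable_fun_pair; exact: measurable_tnth.
rewrite [LHS]integral_powerPS// (fubini_tonelli1 (m1 := P) (m2 := P) f)//.
apply: eq_integral => x _.
have -> : (fun y : 1.-tuple T => f (tnth (consp (x, y)) ord0,
    tnth (consp (x, y)) ord_max)) = fun y : 1.-tuple T => f (x, tnth y ord0).
  apply/funext => y; congr (f (_, _)).
  by rewrite (_ : ord_max = lift ord0 ord0) ?tnthS//; exact: val_inj.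
have mfx : measurable_fun setT (fun y => f (x, y)) by exact: measurable_pair_l.
rewrite integral_powerPS//; last exact: measurableT_comp mfx (measurable_tnth _).
apply: eq_integral => y _; rewrite integral_dirac//=; last first.
  by apply: (measurableT_comp mfx); exact: measurable_cst.
by rewrite diracT mul1e.
Qed.

Section GoodPoints.
Context {R : realType}.
Local Notation E3 := (space3 R).

(* The kernel is singular at the north pole. *)
Definition good_point : set E3 := [set x | sphere x /\ x.2 < 1].

Let south : E3 := ((0, 0), -1).

(** Seen as a cap of height -1 around the south pole, the set of good points gets full measure from
    the cap formula. This also shows that [sigma] is carried by the sphere. *)
Let good_pointE : good_point = [set y | sphere y /\ -1 < dot south y].
Proof.
have e y : (-1 < dot south y) = (y.2 < 1).
  by rewrite (_ : dot south y = - y.2) ?ltrN2// /dot /=; ring.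
by apply/seteqP; split => y /=; rewrite e.
Qed.

Lemma measurable_sphere : measurable (@sphere R).
Proof.
rewrite (_ : sphere = enorm @^-1` [set 1]).
  apply: (measurable_preim measurable_enorm); exact: measurable_set1.
by [].
Qed.

Lemma measurable_good_point : measurable good_point.
Proof.
apply: measurableI; first exact: measurable_sphere.
exact: measurable_lt_sets.
Qed.

Lemma sigma_good_point : sigma good_point = 1%E.
Proof.
rewrite good_pointE sigma_cap//; first by congr EFin; field.
  by apply/sphereE; rewrite /dot /=; ring.
by rewrite lexx /=; lra.
Qed.

(* The squared modulus of the kernel, up to N ^ 2; the truncation at 1 only acts
   off the sphere. *)
Definition kern n (p : E3 * E3) : R :=
  Num.min 1 (`|similarity p.1 p.2| ^+ n).

Lemma kern_ge0 n p : 0 <= kern n p.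
Proof. by rewrite /kern le_min ler01 exprn_ge0. Qed.

Lemma kern_le1 n p : kern n p <= 1.
Proof. by rewrite /kern ge_min lexx. Qed.

Lemma similarity_bounds (x y : E3) : sphere x -> sphere y ->
  0 <= similarity x y <= 1.
Proof.
move=> /sphere_dot sx /sphere_dot sy; rewrite /similarity.
have h1 : 0 <= (x.1.1 - y.1.1) ^+ 2 + (x.1.2 - y.1.2) ^+ 2 + (x.2 - y.2) ^+ 2.
  by rewrite !addr_ge0// sqr_ge0.
have h2 : 0 <= (x.1.1 + y.1.1) ^+ 2 + (x.1.2 + y.1.2) ^+ 2 + (x.2 + y.2) ^+ 2.
  by rewrite !addr_ge0// sqr_ge0.
by rewrite /dot; apply/andP; split; lra.
Qed.

Lemma kernE n (x y : E3) : sphere x -> sphere y ->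
  kern n (x, y) = similarity x y ^+ n.
Proof.
move=> sx sy; have /andP[s0 s1] := similarity_bounds sx sy.
by rewrite /kern /= ger0_norm// min_r// exprn_ile1.
Qed.

Lemma measurable_dot : measurable_fun setT (fun p : E3 * E3 => dot p.1 p.2).
Proof.
have m1 := measurable_fst (T1 := E3) (T2 := E3).
have m2 := measurable_snd (T1 := E3) (T2 := E3).
have c1 := @measurable_x1 R; have c2 := @measurable_x2 R.
by apply: measurable_funD; [apply: measurable_funD|]; apply: measurable_funM;
  do [exact: (measurableT_comp c1)|exact: (measurableT_comp c2)
     |exact: (measurableT_comp measurable_snd)].
Qed.

Lemma measurable_kern n : measurable_fun setT (kern n).
Proof.
apply: measurable_minr => //; apply: measurable_funX.
apply: measurableT_comp => //; apply: measurable_funM => //.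
by apply: measurable_funD => //; exact: measurable_dot.
Qed.

End GoodPoints.

(** * One-point and two-point laws of the spherical ensemble *)

Section SphericalEnsemble.
Context {R : realType} (N : nat) (X : point_process R N).
Hypotheses (hX : spherical_ensemble X) (N1 : (1 < N)%N).
Local Notation E3 := (space3 R).
Local Open Scope ereal_scope.

Let N0 : (0 < N)%N := ltnW N1.

Lemma ae_good_points k : {ae powerP (@sigma R) k, forall x i, good_point (tnth x i)}.
Proof.
apply: (@filterS _ _ _ (fun x => forall i, i \in enum 'I_k -> good_point (tnth x i))).
  by move=> x h i; apply: h; rewrite mem_enum.
elim: (enum _) => [|i s IH]; first exact: filterE.
have := ae_powerP_tnth i measurable_good_point (@sigma_good_point R).
apply: filterS2 IH => x h h' j; rewrite inE => /predU1P[->//|]; exact: h.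
Qed.

Lemma reduced_density1 :
  {ae powerP sigma 1, forall x, reduced_density X N0 x = 1%R}.
Proof.
apply: filterS2 (hX N0 isT) (ae_good_points 1) => x h g.
apply: complexI; rewrite h spherical_det1//; first by case: (g ord0).
by case: (g ord0).
Qed.

Definition pair_density (p : E3 * E3) : R :=
  (N%:R / N.-1%:R * (1 - kern N.-1 p))%R.

Lemma pair_density_ge0 p : (0 <= pair_density p)%R.
Proof. by rewrite mulr_ge0// ?divr_ge0// subr_ge0 kern_le1. Qed.

Lemma measurable_pair_density : measurable_fun setT pair_density.
Proof. by apply: measurable_funM => //; apply: measurable_funB => //; exact: measurable_kern. Qed.

Lemma reduced_density2 :
  {ae powerP sigma 2, forall x,
    reduced_density X N1 x = pair_density (tnth x ord0, tnth x ord_max)}.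
Proof.
apply: filterS2 (hX N1 isT) (ae_good_points 2) => x h g.
apply: complexI; rewrite h spherical_det2//; [|by move=> i; case: (g i)..].
by rewrite /pair_density kernE//; [case: (g ord0)|case: (g ord_max)].
Qed.

Lemma measurable_tnth_set (n : nat) (i : 'I_n) (A : set E3) : measurable A ->
  measurable [set x : n.-tuple E3 | A (tnth x i)].
Proof. exact: (measurable_preim (measurable_tnth i)). Qed.

(** Exchangeability moves the point [i] to the front, where the first marginal has density 1. The
    two-point law follows the same pattern. *)
Lemma one_point_law (i : 'I_N) (A : set E3) : measurable A ->
  pp_prob X [set w | A (tnth (pp_points X w) i)] = sigma A.
Proof.
move=> mA; pose i0 := widen_ord N0 ord0.
transitivity (pp_prob X [set w | A (tnth (pp_points X w) i0)]).
  rewrite -(pp_exchange X (tperm i0 i) (measurable_tnth_set i0 mA)).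
  congr (pp_prob X _); apply/seteqP; split => w /=;
    by rewrite tnth_mktuple tpermL.
have := pp_marginal X N0 (measurable_tnth_set (ord0 : 'I_1) mA).
rewrite (_ : [set w | _] = [set w | A (tnth (pp_points X w) i0)]); last first.
  by apply/seteqP; split => w /=; rewrite tnth_mktuple.
move=> ->; rewrite -(powerP_tnth sigma (ord0 : 'I_1) mA).
transitivity (\int[powerP sigma 1]_(x in [set x | A (tnth x ord0)]) 1).
  apply: ge0_ae_eq_integral => //.
  - exact: measurable_tnth_set.
  - by apply/measurable_funTS/measurable_EFinP; exact: measurable_reduced_density.
  - by move=> x _; rewrite lee_fin; apply: Rintegral_ge0 => y _; exact: pp_density_ge0.
  - by apply: filterS reduced_density1 => x /= ->.
by rewrite (integral_cst _ _ 1)// ?mul1e//; exact: measurable_tnth_set.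
Qed.

Lemma exists_perm2 (i0 i1 i j : 'I_N) : i0 != i1 -> i != j ->
  exists s : 'S_N, s i0 = i /\ s i1 = j.
Proof.
(* Permutations compose from left to right: the first transposition sends [i0] to [i], the second
   one takes the image of [i1] to [j] and fixes [i]. *)
move=> i01 ij; exists (tperm i0 i * tperm (tperm i0 i i1) j)%g.
rewrite !permM tpermL tpermL; split => //.
apply: tpermD; last by rewrite eq_sym.
by rewrite -{2}(tpermL i0 i) (inj_eq perm_inj) eq_sym.
Qed.

Lemma two_point_law (i j : 'I_N) (A B : set E3) : i != j ->
  measurable A -> measurable B ->
  pp_prob X [set w | A (tnth (pp_points X w) i) /\ B (tnth (pp_points X w) j)] =
  \int[sigma \x sigma]_p (pair_density p * \1_(A `*` B) p)%:E.
Proof.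
move=> ij mA mB; pose i0 := widen_ord N1 ord0; pose i1 := widen_ord N1 ord_max.
have i01 : i0 != i1 by [].
have [s [si sj]] := exists_perm2 i01 ij.
have mAB n (k l : 'I_n) :
    measurable [set x : n.-tuple E3 | A (tnth x k) /\ B (tnth x l)].
  by apply: measurableI; exact: measurable_tnth_set.
transitivity (pp_prob X [set w | A (tnth (pp_points X w) i0) /\
                                 B (tnth (pp_points X w) i1)]).
  rewrite -(pp_exchange X s (mAB _ i0 i1)).
  congr (pp_prob X _); apply/seteqP; split => w /=;
    by rewrite !tnth_mktuple si sj.
have := pp_marginal X N1 (mAB _ ord0 ord_max).
rewrite (_ : [set w | _] = [set w | A (tnth (pp_points X w) i0) /\
    B (tnth (pp_points X w) i1)]); last first.
  by apply/seteqP; split => w /=; rewrite !tnth_mktuple.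
move=> ->.
have mpd := measurable_pair_density.
have mpair : measurable_fun setT
    (fun x : 2.-tuple E3 => (tnth x ord0, tnth x ord_max)).
  by apply: measurable_fun_pair; exact: measurable_tnth.
have mAxB : measurable (A `*` B) by exact: measurableX.
rewrite -(integral_powerP2 sigma (f := fun p => (pair_density p * \1_(A `*` B) p)%:E)); last 2 first.
- by apply/measurable_EFinP/measurable_funM => //; exact: measurable_indic.
- by move=> p; rewrite lee_fin mulr_ge0// pair_density_ge0.
transitivity (\int[powerP sigma 2]_(x in [set x | A (tnth x ord0) /\ B (tnth x ord_max)])
    (pair_density (tnth x ord0, tnth x ord_max))%:E).
  apply: ge0_ae_eq_integral => //.
  - exact: mAB.
  - by apply/measurable_funTS/measurable_EFinP; exact: measurable_reduced_density.
  - by apply/measurable_funTS/measurable_EFinP; exact: measurableT_comp mpd mpair.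
  - by move=> x _; rewrite lee_fin; apply: Rintegral_ge0 => y _; exact: pp_density_ge0.
  - by move=> x _; rewrite lee_fin pair_density_ge0.
  - by apply: filterS reduced_density2 => x /= ->.
rewrite integral_mkcond epatch_indic; apply: eq_integral => x _.
rewrite [RHS]EFinM; congr (_ * _).
Qed.

End SphericalEnsemble.

(** * Moments of the counting variable *)

Section SecondMoment.
Context {R : realType} (N : nat) (X : point_process R N).
Hypotheses (hX : spherical_ensemble X) (N1 : (1 < N)%N).
Local Notation E3 := (space3 R).
Local Notation sigma2 := (@sigma R \x @sigma R)%E.
Local Notation P := (pp_prob X).
Local Open Scope ereal_scope.

Let N0 : (0 < N)%N := ltnW N1.

Definition kern_mass n (S : set (E3 * E3)) : \bar R :=
  \int[sigma2]_p (kern n p * \1_S p)%:E.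

Lemma measurable_kern_indic n (S : set (E3 * E3)) : measurable S ->
  measurable_fun setT (fun p => (kern n p * \1_S p)%:E).
Proof.
move=> mS; apply/measurable_EFinP/measurable_funM; first exact: measurable_kern.
exact: measurable_indic.
Qed.

Lemma kern_indic_ge0 n (S : set (E3 * E3)) p : 0 <= (kern n p * \1_S p)%:E.
Proof. by rewrite lee_fin mulr_ge0// kern_ge0. Qed.

Lemma kern_mass_fin_num n (S : set (E3 * E3)) : measurable S ->
  kern_mass n S \is a fin_num.
Proof.
move=> mS; rewrite ge0_fin_numE; last first.
  by apply: integral_ge0 => p _; exact: kern_indic_ge0.
apply: (@le_lt_trans _ _ (\int[sigma2]_p 1)); last first.
  by rewrite (integral_prob_cst sigma2) ltry.
apply: ge0_le_integral => //.
- by move=> p _; exact: kern_indic_ge0.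
- exact: measurable_kern_indic.
- by move=> p _; rewrite lee_fin mulr_ile1 ?kern_ge0 ?kern_le1// indicE; case: (_ \in _).
Qed.

Lemma kern_massU n (S T : set (E3 * E3)) : measurable S -> measurable T ->
  [disjoint S & T] -> kern_mass n (S `|` T) = kern_mass n S + kern_mass n T.
Proof.
move=> mS mT ST; rewrite /kern_mass -ge0_integralD//.
- apply: eq_integral => p _; rewrite -EFinD -mulrDr; congr (_ * _)%:E.
  rewrite !indicE in_setU; have [pS|pS] := boolP (p \in S);
    have [pT|pT] := boolP (p \in T); rewrite /= ?addr0 ?add0r//.
  by move/disj_set2P: ST => /seteqP[/(_ p)] h _; case: h; split; exact: set_mem.
- by move=> p _; exact: kern_indic_ge0.
- exact: measurable_kern_indic.
- by move=> p _; exact: kern_indic_ge0.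
- exact: measurable_kern_indic.
Qed.

Definition pair_mass (S : set (E3 * E3)) : \bar R :=
  \int[sigma2]_p (pair_density N p * \1_S p)%:E.

(** The pair density and the rescaled kernel add up to the constant N / (N - 1). The additive form
    keeps all integrands nonnegative and avoids subtracting extended integrals. *)
Lemma pair_mass_kern (A B : set E3) : measurable A -> measurable B ->
  pair_mass (A `*` B) + (N%:R / N.-1%:R)%:E * kern_mass N.-1 (A `*` B) =
  (N%:R / N.-1%:R)%:E * (sigma A * sigma B).
Proof.
move=> mA mB; have mS : measurable (A `*` B) by exact: measurableX.
have c0 : (0 <= N%:R / N.-1%:R :> R)%R by rewrite divr_ge0.
transitivity (pair_mass (A `*` B) +
    \int[sigma2]_p ((N%:R / N.-1%:R)%:E * (kern N.-1 p * \1_(A `*` B) p)%:E)).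
  rewrite ge0_integralZl//; first exact: measurable_kern_indic.
  by move=> p _; exact: kern_indic_ge0.
rewrite -ge0_integralD//; first last.
- by apply: measurable_funeM; exact: measurable_kern_indic.
- by move=> p _; rewrite mule_ge0// kern_indic_ge0.
- apply/measurable_EFinP/measurable_funM; first exact: measurable_pair_density.
  exact: measurable_indic.
- by move=> p _; rewrite lee_fin mulr_ge0// pair_density_ge0.
transitivity (\int[sigma2]_p ((N%:R / N.-1%:R)%:E * (\1_(A `*` B) p)%:E)).
  apply: eq_integral => p _; rewrite -!EFinM -EFinD /pair_density; congr EFin; ring.
rewrite ge0_integralZl//; last by apply/measurable_EFinP; exact: measurable_indic.
congr (_ * _); apply: etrans (integral_indicT sigma2 mS) _.
exact: product_measure1E.
Qed.

Lemma measurable_point_set (i : 'I_N) (A : set E3) : measurable A ->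
  measurable [set w | A (tnth (pp_points X w) i)].
Proof.
apply: (measurable_preim (f := fun w => tnth (pp_points X w) i)).
exact: (measurableT_comp (measurable_tnth i)).
Qed.

Lemma pair_mass_law (i j : 'I_N) (A B : set E3) : i != j ->
  measurable A -> measurable B ->
  P [set w | A (tnth (pp_points X w) i) /\ B (tnth (pp_points X w) j)] =
  pair_mass (A `*` B).
Proof. exact: (two_point_law hX N1). Qed.

Lemma pair_mass_setT (A : set E3) : measurable A ->
  pair_mass (A `*` setT) = sigma A.
Proof.
move=> mA; pose i0 := widen_ord N1 ord0; pose i1 := widen_ord N1 ord_max.
rewrite -(@pair_mass_law i0 i1)// -(one_point_law hX N1 i0 mA).
by congr (P _); apply/seteqP; split => w /=; [case|].
Qed.

Lemma pair_mass_fin_num (A B : set E3) : measurable A -> measurable B ->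
  pair_mass (A `*` B) \is a fin_num.
Proof.
move=> mA mB; pose i0 := widen_ord N1 ord0; pose i1 := widen_ord N1 ord_max.
rewrite -(@pair_mass_law i0 i1)// fin_num_measure//.
by apply: measurableI; exact: measurable_point_set.
Qed.

Let Npos : (N%:R : R) != 0%R. Proof. by rewrite pnatr_eq0 -lt0n. Qed.
Let N1pos : (N.-1%:R : R) != 0%R.
Proof. by rewrite pnatr_eq0 -lt0n -ltnS prednK. Qed.
Let N1E : (N.-1%:R : R) = (N%:R - 1)%R.
Proof. by rewrite -[in RHS](prednK N0) -natr1 addrK. Qed.

(* The reproducing property of the kernel, obtained by comparing the one-point
   law with the marginal of the two-point law. *)
Lemma kern_mass_setT (A : set E3) : measurable A ->
  N%:R%:E * kern_mass N.-1 (A `*` setT) = sigma A.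
Proof.
move=> mA; have := pair_mass_kern mA measurableT; rewrite pair_mass_setT//.
have mS : measurable (A `*` (setT : set E3)) by exact: measurableX.
rewrite probability_setT mule1.
have aE : (fine (sigma A))%:E = sigma A by rewrite fineK// fin_num_measure.
have kE : (fine (kern_mass N.-1 (A `*` setT)))%:E = kern_mass N.-1 (A `*` setT).
  by rewrite fineK// kern_mass_fin_num.
rewrite -aE -kE -!EFinM -EFinD => -[h]; congr EFin.
have : (N.-1%:R * (fine (sigma A) + N%:R / N.-1%:R * fine (kern_mass N.-1 (A `*` setT))) =
   N%:R * fine (sigma A))%R by rewrite h mulrA mulrCA divff ?mulr1.
rewrite mulrDr mulrA [(N.-1%:R * (_ / _))%R]mulrCA divff// mulr1 N1E; lra.
Qed.

Lemma first_moment (C : set E3) : measurable C ->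
  'E_P[fun w => count_in C (pp_points X w)] = (N%:R * fine (sigma C))%:E.
Proof.
move=> mC; rewrite unlock /count_in.
have mi (i : 'I_N) := measurable_point_set i mC.
transitivity (\int[P]_w \sum_(i < N) (\1_C (tnth (pp_points X w) i))%:E).
  by apply: eq_integral => w _; rewrite sumEFin.
have me (i : 'I_N) w :
    \1_C (tnth (pp_points X w) i) = \1_[set w | C (tnth (pp_points X w) i)] w :> R.
  by rewrite indic_comp.
rewrite ge0_integral_sum//; last first.
  move=> i; apply/measurable_EFinP; under eq_fun do rewrite me.
  exact: measurable_indic.
rewrite (eq_bigr (fun=> (fine (sigma C))%:E)); last first.
  move=> i _; under eq_integral do rewrite me.
  apply: etrans (integral_indicT P (mi i)) _.
  apply: etrans (one_point_law hX N1 i mC) _.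
  by rewrite fineK// fin_num_measure.
by rewrite sumEFin sumr_const card_ord mulr_natl.
Qed.

(** With a the measure of C, and k, k' the kernel masses of C x C and of C x ~C, the diagonal pairs
    contribute N a and the others N (N a^2 - N k). The reproducing property, a = N (k + k'), turns
    the diagonal term into kernel mass and cancels k. *)
Lemma second_moment (C : set E3) : measurable C ->
  'E_P[fun w => (count_in C (pp_points X w) ^+ 2)%R] =
  (N%:R ^+ 2 * (fine (sigma C) ^+ 2 + fine (kern_mass N.-1 (C `*` ~` C))))%:E.
Proof.
move=> mC; rewrite unlock /count_in.
pose S (i j : 'I_N) := [set w | C (tnth (pp_points X w) i) /\ C (tnth (pp_points X w) j)].
have mi (i : 'I_N) := measurable_point_set i mC.
have mS i j : measurable (S i j) by apply: measurableI; exact: mi.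
transitivity (\int[P]_w \sum_(i < N) \sum_(j < N) (\1_(S i j) w)%:E).
  apply: eq_integral => w _; rewrite expr2 mulr_suml -sumEFin.
  apply: eq_bigr => i _; rewrite mulr_sumr -sumEFin; apply: eq_bigr => j _.
  rewrite -!(indic_comp _ (fun w => tnth (pp_points X w) _)).
  by rewrite (_ : S i j = [set w | C (tnth (pp_points X w) i)] `&`
      [set w | C (tnth (pp_points X w) j)])// indicI.
have mind i j : measurable_fun setT (fun w => (\1_(S i j) w)%:E : \bar R).
  by apply/measurable_EFinP; exact: measurable_indic.
rewrite ge0_integral_sum//; last 2 first.
- by move=> i; exact: emeasurable_sum.
- by move=> i w _; apply: sume_ge0 => j _; rewrite lee_fin.
pose a := fine (sigma C); pose q := fine (pair_mass (C `*` C)).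
have aE : a%:E = sigma C by rewrite fineK// fin_num_measure.
have qE : q%:E = pair_mass (C `*` C) by rewrite fineK// pair_mass_fin_num.
transitivity (\sum_(i < N) (a + N.-1%:R * q)%:E).
  apply: eq_bigr => i _; rewrite ge0_integral_sum// (bigD1 i)//= EFinD; congr (_ + _).
    apply: etrans (integral_indicT P (mS i i)) _; rewrite aE -(one_point_law hX N1 i mC).
    by congr (P _); apply/seteqP; split => w /=; [case|].
  rewrite (eq_bigr (fun=> q%:E)); last first.
    move=> j ji; apply: etrans (integral_indicT P (mS i j)) _.
    rewrite qE -(@pair_mass_law i j)//.
    by rewrite eq_sym.
  rewrite sumEFin sumr_const (eq_card (B := predC1 i)); last by [].
  by rewrite cardC1 card_ord mulr_natl.
rewrite sumEFin sumr_const card_ord; congr EFin; rewrite -[LHS]mulr_natl.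
have mCC : measurable (C `*` C) by exact: measurableX.
have mCD : measurable (C `*` ~` C) by apply: measurableX => //; exact: measurableC.
pose k := fine (kern_mass N.-1 (C `*` C)).
pose k' := fine (kern_mass N.-1 (C `*` ~` C)).
have kE : k%:E = kern_mass N.-1 (C `*` C) by rewrite fineK// kern_mass_fin_num.
have kE' : k'%:E = kern_mass N.-1 (C `*` ~` C) by rewrite fineK// kern_mass_fin_num.
have h1 : (q + N%:R / N.-1%:R * k = N%:R / N.-1%:R * (a * a))%R.
  have := pair_mass_kern mC mC.
  by rewrite -aE -kE -qE -!EFinM -EFinD => -[].
have h2 : (N%:R * (k + k') = a)%R.
  have := kern_mass_setT mC.
  rewrite (_ : C `*` setT = (C `*` C) `|` (C `*` ~` C)); last first.
    apply/seteqP; split => -[x y] /=; last by case=> -[].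
    by move=> [Cx _]; have [Cy|Cy] := pselect (C y); [left|right].
  rewrite kern_massU//; first by rewrite -aE -kE -kE' -EFinD -EFinM => -[].
  by apply/disj_set2P/seteqP; split => // -[x y] /= [[_ ?] [_ ?]].
have h3 : (N.-1%:R * q = N%:R * (a * a) - N%:R * k)%R.
  have -> : (q = N%:R / N.-1%:R * (a * a) - N%:R / N.-1%:R * k)%R by rewrite -h1 addrK.
  by field.
by rewrite h3 -/a -/k' -[X in (_ * (X + _) = _)%R]h2; ring.
Qed.

End SecondMoment.

(** * The strip estimate *)

Section Strip.
Context {R : realType}.
Local Notation E3 := (space3 R).

Definition chord2 (x y : E3) : R :=
  (x.1.1 - y.1.1) ^+ 2 + (x.1.2 - y.1.2) ^+ 2 + (x.2 - y.2) ^+ 2.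

Lemma chord2_ge0 x y : 0 <= chord2 x y.
Proof. by rewrite /chord2 !addr_ge0// sqr_ge0. Qed.

Lemma chord2E (x y : E3) : sphere x -> sphere y ->
  chord2 x y = 2 - 2 * dot x y.
Proof.
by move=> /sphere_dot sx /sphere_dot sy; rewrite /chord2 /dot; lra.
Qed.

Lemma chord_triangle (x y z : E3) :
  Num.sqrt (chord2 x z) <= Num.sqrt (chord2 x y) + Num.sqrt (chord2 y z).
Proof.
have sE a b : 0 <= Num.sqrt (chord2 a b) /\
    Num.sqrt (chord2 a b) ^+ 2 = chord2 a b.
  by rewrite sqrtr_ge0 sqr_sqrtr ?chord2_ge0.
have [xy0 xy2] := sE x y; have [yz0 yz2] := sE y z; have [xz0 xz2] := sE x z.
rewrite -ler_sqr ?nnegrE ?addr_ge0// xz2 sqrrD xy2 yz2.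
pose c := (x.1.1 - y.1.1) * (y.1.1 - z.1.1) + (x.1.2 - y.1.2) * (y.1.2 - z.1.2) +
  (x.2 - y.2) * (y.2 - z.2).
have -> : chord2 x z = chord2 x y + c *+ 2 + chord2 y z.
  by rewrite /chord2 /c -mulr_natr; ring.
rewrite lerD2r lerD2l lerMn2r /=.
(* Cauchy-Schwarz, from Lagrange's identity *)
have cs : c ^+ 2 <= (Num.sqrt (chord2 x y) * Num.sqrt (chord2 y z)) ^+ 2.
  rewrite exprMn xy2 yz2 -subr_ge0.
  pose u1 := x.1.1 - y.1.1; pose u2 := x.1.2 - y.1.2; pose u3 := x.2 - y.2.
  pose v1 := y.1.1 - z.1.1; pose v2 := y.1.2 - z.1.2; pose v3 := y.2 - z.2.
  rewrite (_ : _ - _ = (u1 * v2 - u2 * v1) ^+ 2 + (u1 * v3 - u3 * v1) ^+ 2 +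
    (u2 * v3 - u3 * v2) ^+ 2); first by rewrite !addr_ge0// sqr_ge0.
  by rewrite /chord2 /c -/u1 -/u2 -/u3 -/v1 -/v2 -/v3; ring.
apply: le_trans (ler_norm c) _.
by rewrite -ler_sqr ?nnegrE ?mulr_ge0// real_normK ?num_real.
Qed.

Lemma dot_bounds (x y : E3) : sphere x -> sphere y -> -1 <= dot x y <= 1.
Proof.
by move=> sx sy; have := similarity_bounds sx sy; rewrite /similarity; lra.
Qed.

Lemma sigma_sphere : sigma (@sphere R) = 1%E.
Proof.
apply/eqP; rewrite eq_le; apply/andP; split.
  by apply: probability_le1; exact: measurable_sphere.
rewrite -(@sigma_good_point R); apply: le_measure; rewrite ?inE.
- exact: measurable_good_point.
- exact: measurable_sphere.
- by move=> x [].
Qed.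

Lemma ae_sphere : {ae sigma, forall c, @sphere R c}.
Proof.
have mS := @measurable_sphere R.
exists (~` @sphere R); split => //; first exact: measurableC.
by rewrite probability_setC// sigma_sphere subee.
Qed.

Lemma sigma_setI_sphere (A : set E3) : measurable A ->
  sigma (A `&` sphere) = sigma A.
Proof.
move=> mA; have mS := @measurable_sphere R.
apply/eqP; rewrite eq_le; apply/andP; split.
  by apply: le_measure; rewrite ?inE//; exact: measurableI.
rewrite -{1}(setIT A) -(setUv sphere) setIUr.
apply: le_trans (measureU2 _ _ _) _; [exact: measurableI|
  by apply: measurableI => //; exact: measurableC|].
rewrite [X in (_ + X)%E](_ : _ = 0%E) ?adde0//.
apply/eqP; rewrite -measure_le0.
apply: (@le_trans _ _ (sigma (~` @sphere R))).
  by apply: le_measure; rewrite ?inE; [apply: measurableI => //|..];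
    do ?exact: measurableC; exact: subIsetr.
by rewrite probability_setC// sigma_sphere subee.
Qed.

(** The distance between two unit vectors of inner product [t]. In this parameter a cap of chord r
    has measure r^2 / 4. *)
Definition chord (t : R) : R := Num.sqrt (2 - 2 * t).

Lemma measurable_halfspace (x : E3) (t : R) : measurable [set c : E3 | t < dot x c].
Proof. by apply: measurable_lt_sets => //; exact: measurable_dotr. Qed.

(* The points whose chord to x is less than chord t but whose chord to y is not
   lie in an annulus around x of width at most the chord from x to y. *)
Lemma sigma_strip (x y : E3) (t : R) : sphere x -> sphere y -> -1 <= t <= 1 ->
  (sigma [set c | (t < dot c x)%R /\ ~ (t < dot c y)%R] <=
   (chord t * chord (dot x y) / 2)%:E)%E.
Proof.
move=> sx sy t1; have /andP[d1 d2] := dot_bounds sx sy.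
have mD : measurable [set c : E3 | t < dot c x /\ ~ (t < dot c y)].
  under eq_set do rewrite (dotC _ x) (dotC _ y).
  apply: measurableI; first exact: measurable_halfspace.
  by apply: measurableC; exact: measurable_halfspace.
rewrite -sigma_setI_sphere//; set D := _ `&` _.
have mDs : measurable D by apply: measurableI => //; exact: measurable_sphere.
set r := chord t; set e := chord (dot x y).
have r0 : 0 <= r by exact: sqrtr_ge0.
have e0 : 0 <= e by exact: sqrtr_ge0.
have r2 : r ^+ 2 = 2 - 2 * t by rewrite /r /chord sqr_sqrtr; lra.
have e2 : e ^+ 2 = 2 - 2 * dot x y by rewrite /e /chord sqr_sqrtr; lra.
pose A s := [set c | sphere c /\ s < dot x c].
have mA s : measurable (A s).
  by apply: measurableI; [exact: measurable_sphere|exact: measurable_halfspace].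
have AE s : -1 <= s <= 1 -> sigma (A s) = ((1 - s) / 2)%:E by exact: sigma_cap.
have DA : D `<=` A t by move=> c [[h _] sc]; split => //; rewrite dotC.
(* If [e] exceeds [r], the measure r^2 / 4 of the whole cap is already below the bound r e / 2. *)
have [er|re] := leP e r; last first.
  apply: (@le_trans _ _ (sigma (A t))); first by apply: le_measure; rewrite ?inE.
  by rewrite AE// lee_fin; nra.
(* The inner product at chord distance [r - e]: a centre closer than that to x is at distance less
   than [r] from y. *)
pose T := 1 - (r - e) ^+ 2 / 2.
have T1 : -1 <= T <= 1.
  have r4 : r ^+ 2 <= 2 ^+ 2 by rewrite r2; lra.
  have r2' : r <= 2 by rewrite -ler_sqr ?nnegrE.
  by rewrite /T; apply/andP; split; nra.
have tT : t <= T by rewrite /T; nra.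
have DAT : D `<=` A t `\` A T.
  move=> c Dc; split; first exact: DA.
  move: Dc => [[tx ty] sc] [_ Tc]; apply: ty.
  have := chord_triangle c x y.
  rewrite !chord2E// -/(chord (dot x y)) -/e => tri.
  have cx : Num.sqrt (2 - 2 * dot c x) < r - e.
    rewrite -(ltr_pXn2r (n := 2))// ?nnegrE ?sqrtr_ge0 ?subr_ge0//.
    rewrite dotC sqr_sqrtr; last by have := dot_bounds sx sc; lra.
    by move: Tc; rewrite /T; lra.
  have : Num.sqrt (2 - 2 * dot c y) < r by lra.
  rewrite -(ltr_pXn2r (n := 2))// ?nnegrE ?sqrtr_ge0// r2.
  by rewrite sqr_sqrtr; [lra|have := dot_bounds sc sy; lra].
apply: (@le_trans _ _ (sigma (A t `\` A T))).
  by apply: le_measure; rewrite ?inE//; exact: measurableD.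
rewrite measureD//; last by rewrite ltey_eq fin_num_measure.
rewrite setIidr; last by move=> c [sc Tc]; split => //; exact: le_lt_trans Tc.
(* The annulus has measure (r^2 - (r - e)^2) / 4 = (2 r e - e^2) / 4, whence the constant 1/2. *)
apply: (@le_trans _ _ (((1 - t) / 2)%:E - ((1 - T) / 2)%:E)%E).
  by rewrite -(AE t t1) -(AE T T1); exact: lexx.
by rewrite -EFinB lee_fin /T; nra.
Qed.

End Strip.

(** * Averaging over the centre of the cap *)

Section VarianceBound.
Context {R : realType} (phi : R).
Local Notation E3 := (space3 R).
Local Open Scope ereal_scope.

Definition sigma2 : probability (E3 * E3)%type R := (@sigma R \x @sigma R)%E.

Lemma measurable_cap_pairs : measurable [set p : E3 * E3 | cap p.1 phi p.2].
Proof.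
apply: measurableI.
  exact: (measurable_preim measurable_snd (@measurable_sphere R)).
by apply: measurable_lt_sets => //; exact: measurable_dot.
Qed.

Lemma measurable_cap (c : E3) : measurable (cap c phi).
Proof.
exact: (measurable_preim (pair1_measurable c) measurable_cap_pairs).
Qed.

Definition separating : set (E3 * (E3 * E3)) :=
  [set q | cap q.1 phi q.2.1 /\ ~ cap q.1 phi q.2.2].

Lemma measurable_separating : measurable separating.
Proof.
apply: measurableI; last apply: measurableC.
  apply: (measurable_preim (f := fun q : E3 * (E3 * E3) => (q.1, q.2.1)))
    measurable_cap_pairs.
  apply: measurable_fun_pair => //.
  exact: (measurableT_comp measurable_fst measurable_snd).
apply: (measurable_preim (f := fun q : E3 * (E3 * E3) => (q.1, q.2.2)))
  measurable_cap_pairs.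
apply: measurable_fun_pair => //.
exact: (measurableT_comp measurable_snd measurable_snd).
Qed.

Definition cut (c : E3) : set (E3 * E3) := cap c phi `*` ~` cap c phi.

Lemma measurable_cut c : measurable (cut c).
Proof.
by apply: measurableX; [|apply: measurableC]; exact: measurable_cap.
Qed.

Definition mean_cut n : \bar R := \int[sigma]_c kern_mass n (cut c).

Let f n (q : E3 * (E3 * E3)) : \bar R := (kern n q.2 * \1_separating q)%:E.

Let mf n : measurable_fun setT (f n).
Proof.
apply/measurable_EFinP/measurable_funM.
  exact: (measurableT_comp (measurable_kern n) measurable_snd).
by apply: measurable_indic; exact: measurable_separating.
Qed.

Let f0 n q : 0 <= f n q.
Proof. by rewrite lee_fin mulr_ge0// kern_ge0. Qed.

Lemma kern_mass_cutE n c : kern_mass n (cut c) = \int[sigma2]_p f n (c, p).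
Proof.
by apply: eq_integral => p _; rewrite /f; congr (_ * _)%:E.
Qed.

Lemma measurable_kern_mass_cut n :
  measurable_fun setT (fun c => kern_mass n (cut c)).
Proof.
under eq_fun do rewrite kern_mass_cutE.
exact: (measurable_fun_fubini_tonelli_F (m2 := sigma2) (f n)).
Qed.

Lemma mean_cutE n : mean_cut n =
  \int[sigma2]_p ((kern n p)%:E * sigma [set c | separating (c, p)]).
Proof.
rewrite /mean_cut; under eq_integral do rewrite kern_mass_cutE.
rewrite (fubini_tonelli (m1 := sigma) (m2 := sigma2) (f n))//.
apply: eq_integral => p _.
have mS : measurable [set c | separating (c, p)].
  exact: (measurable_preim (pair2_measurable p) measurable_separating).
rewrite -(integral_indicT sigma mS) -ge0_integralZl//; last 2 first.
- by apply/measurable_EFinP; exact: measurable_indic.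
- by rewrite lee_fin kern_ge0.
Qed.

(** The truncation at 1 preserves monotonicity off the sphere too, so [strip_bound] is nonnegative
    everywhere and not only almost everywhere. *)
Lemma kern_decr n (p : E3 * E3) : (kern n.+1 p <= kern n p)%R.
Proof.
rewrite /kern; have [h|h] := leP `|similarity p.1 p.2|%R 1%R.
  by rewrite le_min2 //; apply: ler_wiXn2l.
by rewrite [leRHS]min_l ?ge_min ?lexx// exprn_ege1// ltW.
Qed.

Lemma sigma_cap_sphere (c : E3) : sphere c ->
  sigma (cap c phi) = ((1 - cos phi) / 2)%:E.
Proof. by move=> sc; apply: sigma_cap => //; rewrite cos_geN1 cos_le1. Qed.

(** On the sphere, s^n times the strip estimate after AM-GM; the factor s^n (1 - s) is written as a
    difference of consecutive kernels, whose integrals are known. *)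
Definition strip_bound (N n : nat) (p : E3 * E3) : R :=
  (chord (cos phi) / 2 * (Num.sqrt N%:R * (kern n p - kern n.+1 p) +
                          kern n p / Num.sqrt N%:R))%R.

Lemma strip_bound_ge0 N n p : (0 <= strip_bound N n p)%R.
Proof.
rewrite /strip_bound mulr_ge0 ?divr_ge0 ?sqrtr_ge0// addr_ge0//.
  by rewrite mulr_ge0 ?sqrtr_ge0// subr_ge0 kern_decr.
by rewrite divr_ge0 ?sqrtr_ge0// kern_ge0.
Qed.

Lemma measurable_strip_bound N n : measurable_fun setT (strip_bound N n).
Proof.
have mk := @measurable_kern R.
apply: measurable_funM => //; apply: measurable_funD; apply: measurable_funM => //.
exact: measurable_funB.
Qed.

Lemma ae_sphere2 : {ae sigma2, forall p : E3 * E3, sphere p.1 /\ sphere p.2}.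
Proof.
have mS : measurable (@sphere R `*` @sphere R).
  by apply: measurableX; exact: measurable_sphere.
exists (~` (sphere `*` sphere)); split => //; first exact: measurableC.
rewrite probability_setC// [X in _ - X](_ : _ = 1) ?subee//.
have -> : sigma2 (sphere `*` sphere) = sigma (@sphere R) * sigma (@sphere R).
  by apply: product_measure1E; exact: measurable_sphere.
by rewrite sigma_sphere mule1.
Qed.

(** With [u] for 1 - similarity and [s] for sqrt N, the squares of the two sides differ by (s u -
    1/s)^2. The weight sqrt N gives equality at u = 1/N, the scale on which the kernel decays. *)
Lemma chord_amgm (N : nat) (x y : E3) : (0 < N)%N -> sphere x -> sphere y ->
  (chord (dot x y) <= Num.sqrt N%:R * (1 - similarity x y) + (Num.sqrt N%:R)^-1)%R.
Proof.
move=> N0 sx sy; have /andP[s0 s1] := similarity_bounds sx sy.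
have n0 : (0 < Num.sqrt (N%:R : R))%R by rewrite sqrtr_gt0 ltr0n.
set s := Num.sqrt _ in n0 *; set u := (1 - similarity x y)%R.
have u0 : (0 <= u)%R by rewrite subr_ge0.
have v0 : (0 < s^-1)%R by rewrite invr_gt0.
have su0 : (0 <= s * u + s^-1)%R by rewrite addr_ge0 ?mulr_ge0// ltW.
rewrite /chord -(ger0_norm su0) -sqrtr_sqr ler_sqrt ?sqr_ge0//.
have -> : (2 - 2 * dot x y = 4 * u)%R by rewrite /u /similarity; field.
rewrite -subr_ge0 (_ : _ - _ = (s * u - s^-1) ^+ 2)%R ?sqr_ge0//.
by field; rewrite gt_eqF.
Qed.

Lemma mean_cut_le N n : (0 < N)%N ->
  mean_cut n <= \int[sigma2]_p (strip_bound N n p)%:E.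
Proof.
move=> N0; rewrite mean_cutE; apply: ae_ge0_le_integral => //.
- by move=> p _; rewrite mule_ge0// lee_fin kern_ge0.
- apply: emeasurable_funM; first by apply/measurable_EFinP; exact: measurable_kern.
  apply: (eq_measurable_fun (fun p => sigma (ysection separating p))).
    move=> p _; congr (sigma _); apply/seteqP; split => c /=;
      by rewrite /ysection /= inE.
  by apply: (measurable_fun_ysection sigma); exact: measurable_separating.
- by move=> p _; rewrite lee_fin strip_bound_ge0.
- by apply/measurable_EFinP; exact: measurable_strip_bound.
apply: filterS ae_sphere2 => -[x y] /= [sx sy] _.
have t1 : (-1 <= cos phi <= 1)%R by rewrite cos_geN1 cos_le1.
have /andP[s0 s1] := similarity_bounds sx sy.
apply: (@le_trans _ _ ((kern n (x, y))%:E *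
    (chord (cos phi) * chord (dot x y) / 2)%:E)).
  apply: lee_pmul => //; rewrite ?lee_fin ?kern_ge0//.
  apply: le_trans (sigma_strip sx sy t1).
  apply: (le_measure sigma); rewrite ?inE.
  - exact: (measurable_preim (pair2_measurable (x, y)) measurable_separating).
  - under eq_set do rewrite (dotC _ x) (dotC _ y).
    apply: measurableI; first exact: measurable_halfspace.
    by apply: measurableC; exact: measurable_halfspace.
  - by move=> c [/= [_ h] h']; split => // h''; apply: h'.
rewrite -EFinM lee_fin /strip_bound !kernE// exprSr.
set k := (_ ^+ n)%R; have k0 : (0 <= k)%R by rewrite exprn_ge0.
have am := chord_amgm N0 sx sy.
have c0 : (0 <= k * chord (cos phi) / 2)%R.
  by rewrite divr_ge0// mulr_ge0// sqrtr_ge0.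
have := ler_wpM2l c0 am; move: (Num.sqrt _)^-1%R => v; nra.
Qed.

End VarianceBound.

(** * The number variance *)

Section VarianceFormula.
Context {R : realType} (X : forall N : nat, point_process R N).
Hypothesis hX : forall N : nat, (0 < N)%N -> spherical_ensemble (X N).
Local Notation E3 := (space3 R).
Local Open Scope ereal_scope.

Let hX1 N : (1 < N)%N -> spherical_ensemble (X N).
Proof. by move=> N1; apply: hX; exact: ltnW. Qed.

(** The reproducing property of the ensemble of [n.+1] points, taken over the whole space. *)
Lemma integral_kern n : (0 < n)%N ->
  \int[@sigma2 R]_p (kern n p)%:E = (n.+1%:R^-1)%:E.
Proof.
move=> n0; have n1 : (1 < n.+1)%N by [].
have := kern_mass_setT (hX1 n1) n1 (@measurableT _ E3).
rewrite probability_setT /= => h.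
have -> : \int[sigma2]_p (kern n p)%:E = kern_mass n ((setT : set E3) `*` setT).
  by apply: eq_integral => p _; rewrite setXTT indicT mulr1.
move: h; have mT : measurable ((setT : set E3) `*` (setT : set E3)).
  by rewrite setXTT; exact: measurableT.
rewrite -(fineK (kern_mass_fin_num n mT)) -EFinM => -[h]; congr EFin.
by apply: (@mulfI _ (n.+1%:R)); rewrite ?pnatr_eq0// h divff// pnatr_eq0.
Qed.

Lemma integral_strip_bound (phi : R) n : (0 < n)%N ->
  \int[@sigma2 R]_p (strip_bound phi n.+1 n p)%:E =
  (chord (cos phi) / 2 * (Num.sqrt n.+1%:R * (n.+1%:R^-1 - n.+2%:R^-1) +
    n.+1%:R^-1 / Num.sqrt n.+1%:R))%:E.
Proof.
move=> n0; set r := (chord _ / 2)%R; set s := Num.sqrt _.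
have r0 : (0 <= r)%R by rewrite divr_ge0 ?sqrtr_ge0.
have s0 : (0 <= s)%R by rewrite sqrtr_ge0.
have mk k : measurable_fun setT (fun p : E3 * E3 => (kern k p)%:E).
  by apply/measurable_EFinP; exact: measurable_kern.
have kg k (p : E3 * E3) : 0 <= (kern k p)%:E by rewrite lee_fin kern_ge0.
have intZ k c : (0 <= c)%R -> (0 < k)%N ->
    \int[@sigma2 R]_p (c%:E * (kern k p)%:E) = (c * k.+1%:R^-1)%:E.
  by move=> c0 k0; rewrite ge0_integralZl// integral_kern.
(* The negative term of [strip_bound] goes to the other side, so that only nonnegative functions are
   integrated. *)
have h : \int[@sigma2 R]_p (strip_bound phi n.+1 n p)%:E + (r * s * n.+2%:R^-1)%:E =
    ((r * (s + s^-1)) * n.+1%:R^-1)%:E.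
  have rs0 : (0 <= r * s)%R by rewrite mulr_ge0.
  have rs1 : (0 <= r * (s + s^-1))%R by rewrite mulr_ge0// addr_ge0// invr_ge0.
  rewrite -(intZ n.+1 _ rs0)// -(intZ n _ rs1)//.
  rewrite -ge0_integralD//; first last.
  - exact: measurable_funeM.
  - by move=> p _; rewrite mule_ge0// lee_fin mulr_ge0.
  - by apply/measurable_EFinP; exact: measurable_strip_bound.
  - by move=> p _; rewrite lee_fin strip_bound_ge0.
  apply: eq_integral => p _; rewrite -!EFinM -EFinD /strip_bound -/r -/s.
  by congr EFin; ring.
have -> : (r * (s * (n.+1%:R^-1 - n.+2%:R^-1) + n.+1%:R^-1 / s) =
    r * (s + s^-1) * n.+1%:R^-1 - r * s * n.+2%:R^-1)%R by ring.
by rewrite EFinB -h addeK.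
Qed.

Lemma mean_cut_bound (phi : R) n : (0 < n)%N ->
  (n.+1%:R ^+ 2)%:E * mean_cut phi n <=
  (chord (cos phi) * Num.sqrt n.+1%:R)%:E.
Proof.
move=> n0; have N0 : (0 < n.+1)%N by [].
apply: (@le_trans _ _ ((n.+1%:R ^+ 2)%:E *
    \int[@sigma2 R]_p (strip_bound phi n.+1 n p)%:E)).
  by apply: lee_wpmul2l; [rewrite lee_fin sqr_ge0|exact: mean_cut_le].
rewrite integral_strip_bound// -EFinM lee_fin.
have r0 : (0 <= chord (cos phi))%R by exact: sqrtr_ge0.
set s := Num.sqrt _; have s0 : (0 < s)%R by rewrite sqrtr_gt0 ltr0n.
have s2 : (n.+1%:R = s ^+ 2)%R by rewrite sqr_sqrtr// ler0n.
have s3 : (n.+2%:R = s ^+ 2 + 1)%R by rewrite -s2 natr1.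
rewrite s3 s2.
have q0 : (0 < s ^+ 2 + 1)%R by rewrite ltr_wpDl// sqr_ge0.
(* Each of the two AM-GM terms contributes at most half of the final bound, the first one being
   damped by N / (N + 1). *)
have -> : ((s ^+ 2) ^+ 2 * (chord (cos phi) / 2 *
    (s * ((s ^+ 2)^-1 - (s ^+ 2 + 1)^-1) + (s ^+ 2)^-1 / s)) =
    chord (cos phi) * ((s * (s ^+ 2 / (s ^+ 2 + 1)) + s) / 2))%R.
  by field; rewrite !gt_eqF.
apply: ler_wpM2l => //; rewrite ler_pdivrMr// mulrDr mulr1 lerD2r.
by rewrite ler_piMr ?(ltW s0)// ler_pdivrMr// mul1r lerDl.
Qed.

(** Almost every centre lies on the sphere, where the mean count does not depend on it. The squared
    mean thus cancels, and the averaged kernel mass of a cap against its complement remains. *)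
Lemma number_varianceE (phi : R) n : (0 < n)%N ->
  (number_variance (X n.+1) phi)%:E = (n.+1%:R ^+ 2)%:E * mean_cut phi n.
Proof.
move=> n0; have n1 : (1 < n.+1)%N by [].
pose a : R := ((1 - cos phi) / 2)%R.
have mphi (c : E3) := measurable_cap phi c.
have aeS := @ae_sphere R.
have ma : measurable_fun setT (fun c : E3 => sigma (cap c phi)).
  apply: (eq_measurable_fun (fun c => sigma (xsection [set p : E3 * E3 | cap p.1 phi p.2] c))).
    move=> c _; congr (sigma _); apply/seteqP; split => y /=;
      by rewrite /xsection /= inE.
  by apply: (measurable_fun_xsection sigma); exact: measurable_cap_pairs.
have m1 : \int[@sigma R]_c (fine 'E_(pp_prob (X n.+1))
    [fun w => count_in (cap c phi) (pp_points (X n.+1) w)])%:E = (n.+1%:R * a)%:E.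
  transitivity (\int[@sigma R]_c (n.+1%:R * fine (sigma (cap c phi)))%:E).
    by apply: eq_integral => c _; rewrite (first_moment (hX1 n1) n1 (mphi c)).
  transitivity (\int[@sigma R]_c (n.+1%:R * a)%:E); last exact: integral_prob_cst.
  apply: ae_eq_integral => //.
    apply/measurable_EFinP/measurable_funM => //.
    exact: (measurableT_comp (@fine_measurable R _ measurableT) ma).
  by apply: filterS aeS => c sc _; rewrite sigma_cap_sphere.
have kfin c : kern_mass n (cut phi c) \is a fin_num.
  by apply: kern_mass_fin_num; exact: measurable_cut.
have mk := measurable_kern_mass_cut phi n.
have k0 c : 0 <= kern_mass n (cut phi c).
  by apply: integral_ge0 => p _; exact: kern_indic_ge0.
have m2 : \int[@sigma R]_c (fine 'E_(pp_prob (X n.+1))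
    [fun w => count_in (cap c phi) (pp_points (X n.+1) w) ^+ 2])%:E =
    ((n.+1%:R * a) ^+ 2)%:E + (n.+1%:R ^+ 2)%:E * mean_cut phi n.
  transitivity (\int[@sigma R]_c (n.+1%:R ^+ 2 * (fine (sigma (cap c phi)) ^+ 2 +
      fine (kern_mass n (cut phi c))))%:E).
    by apply: eq_integral => c _; rewrite (second_moment (hX1 n1) n1 (mphi c)).
  transitivity (\int[@sigma R]_c (((n.+1%:R * a) ^+ 2)%:E +
      (n.+1%:R ^+ 2)%:E * kern_mass n (cut phi c))).
    apply: ae_eq_integral => //.
    - apply/measurable_EFinP/measurable_funM => //; apply: measurable_funD.
        apply: measurable_funX.
        exact: (measurableT_comp (@fine_measurable R _ measurableT) ma).
      exact: (measurableT_comp (@fine_measurable R _ measurableT) mk).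
    - by apply: emeasurable_funD => //; exact: measurable_funeM.
    - apply: filterS aeS => c sc _; rewrite sigma_cap_sphere//= -/a.
      rewrite -[in RHS](fineK (kfin c)) -EFinM -EFinD; congr EFin.
      ring.
  rewrite ge0_integralD//.
  - by rewrite integral_prob_cst ge0_integralZl.
  - by move=> c _; rewrite lee_fin sqr_ge0.
  - by move=> c _; rewrite mule_ge0.
  - exact: measurable_funeM.
(* The upper bound supplies the finiteness under which [fine] distributes over the sum. *)
have fK : (n.+1%:R ^+ 2)%:E * mean_cut phi n \is a fin_num.
  rewrite ge0_fin_numE; first exact: le_lt_trans (mean_cut_bound phi n0) (ltry _).
  by rewrite mule_ge0// integral_ge0.
rewrite /number_variance /Rintegral m1 m2 fineD// -[RHS]fineK//; congr EFin.
by rewrite addrC addrA addNr add0r.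
Qed.

Lemma number_variance_bounds (phi : R) N : (1 < N)%N ->
  (0 <= number_variance (X N) phi <= chord (cos phi) * Num.sqrt N%:R)%R.
Proof.
case: N => [//|n] n0; rewrite -!lee_fin number_varianceE//.
rewrite mean_cut_bound// andbT mule_ge0// integral_ge0// => c _.
by apply: integral_ge0 => p _; exact: kern_indic_ge0.
Qed.

End VarianceFormula.

Section ChordAngle.
Context {R : realType}.

Lemma sin_sqr_le (x : R) : 0 <= x -> sin x ^+ 2 <= x ^+ 2.
Proof.
move=> x0; have [|c _] := @MVT_segment R sin cos 0 x x0 (fun y _ => is_derive_sin y).
  by apply: continuous_subspaceT; exact: continuous_sin.
by rewrite sin0 !subr0 => ->; rewrite exprMn ler_piMl ?sqr_ge0.
Qed.

(** The chord is 2 |sin (phi / 2)|, at most the arc that it subtends. *)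
Lemma chord_cos_le (phi : R) : 0 <= phi -> chord (cos phi) <= phi.
Proof.
move=> p0; rewrite /chord -[leRHS]ger0_norm// -sqrtr_sqr ler_sqrt ?sqr_ge0//.
have h : 0 <= phi / 2 by rewrite divr_ge0.
have := sin_sqr_le h; have := cos2Dsin2 (phi / 2).
have -> : cos phi = cos (phi / 2) ^+ 2 - sin (phi / 2) ^+ 2.
  by rewrite !expr2 -cosD -splitr.
by lra.
Qed.

Lemma chord_cos_le2 (phi : R) : chord (cos phi) <= 2.
Proof.
rewrite /chord -[leRHS]ger0_norm// -sqrtr_sqr ler_sqrt ?sqr_ge0//.
by have := cos_geN1 phi; lra.
Qed.

Lemma cap_area_chord (phi : R) : cap_area phi = chord (cos phi) ^+ 2 / 4.
Proof.
have np : sphere (@north R) by apply/sphereE; rewrite /dot /=; ring.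
rewrite /cap_area sigma_cap_sphere//= /chord sqr_sqrtr; first by field.
by have := cos_le1 phi; lra.
Qed.

End ChordAngle.

(** * The three regimes *)

Section Regimes.
Context {R : realType} (X : forall N : nat, point_process R N).
Hypothesis hX : forall N : nat, (0 < N)%N -> spherical_ensemble (X N).

Lemma large_caps : hyperuniform_large_caps X.
Proof.
move=> phi _; apply/eqoP => e e0; near=> N.
have N1 : (1 < N)%N by near: N; exact: nbhs_infty_gt.
have /andP[V0 V1] := number_variance_bounds hX phi N1.
rewrite /= ger0_norm// [`|_|]ger0_norm//.
set s := Num.sqrt N%:R in V1.
have s0 : 0 <= s by rewrite sqrtr_ge0.
have s2 : N%:R = s ^+ 2 by rewrite sqr_sqrtr.
have es : 2 <= e * s.
  (* Chosen so that 2 sqrt N, which bounds the variance, is at most e N. *)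
  have : (2 / e) ^+ 2 <= N%:R by near: N; exact: nbhs_infty_ger.
  rewrite s2 ler_sqr ?nnegrE// ?divr_ge0 ?(ltW e0)//.
  by rewrite ler_pdivrMr// mulrC.
apply: le_trans V1 _; rewrite s2 expr2 mulrA ler_wpM2r//.
exact: le_trans (chord_cos_le2 phi) es.
Unshelve. all: by end_near. Qed.

Lemma small_caps : hyperuniform_small_caps X.
Proof.
move=> phi _ _ /cvgryPge Narea; apply/eqoP => e e0; near=> N.
have N1 : (1 < N)%N by near: N; exact: nbhs_infty_gt.
have /andP[V0 V1] := number_variance_bounds hX (phi N) N1.
have : (2 / e) ^+ 2 <= N%:R * cap_area (phi N) by near: N; exact: Narea.
have a0 : 0 <= cap_area (phi N) by rewrite /cap_area fine_ge0.
rewrite /= ger0_norm// [`|_|]ger0_norm ?mulr_ge0//.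
rewrite cap_area_chord; set r := chord _ in V1 *.
have r0 : 0 <= r by exact: sqrtr_ge0.
set s := Num.sqrt N%:R in V1.
have s0 : 0 <= s by rewrite sqrtr_ge0.
have s2 : N%:R = s ^+ 2 by rewrite sqr_sqrtr.
(* With q = r s / 2, the expected count is q^2 and the variance at most 2 q, so q >= 2 / e
   suffices. *)
rewrite s2 (_ : s ^+ 2 * (r ^+ 2 / 4) = (r * s / 2) ^+ 2); last by field.
have rs0 : 0 <= r * s / 2 by rewrite divr_ge0 ?mulr_ge0.
rewrite ler_sqr ?nnegrE// ?divr_ge0 ?(ltW e0)// ler_pdivrMr// => h.
apply: le_trans V1 _; rewrite expr2 mulrA.
have := ler_wpM2r rs0 h; lra.
Unshelve. all: by end_near. Qed.

Lemma threshold : hyperuniform_threshold X.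
Proof.
(* At angle t / sqrt N the chord is at most the angle, so r sqrt N is at most t and the constant 1
   works. *)
exists 1; near=> t; rewrite mul1r.
have t0 : 0 <= t by near: t; exact: nbhs_pinfty_ge.
rewrite ger0_norm//; set V := fun N : nat => _.
have Vb N : (1 < N)%N -> (0 <= V N <= t%:E)%E.
  move=> N1; have /andP[V0 V1] := number_variance_bounds hX (t / Num.sqrt N%:R) N1.
  rewrite /V !lee_fin V0 /=; apply: le_trans V1 _.
  have s0 : 0 < Num.sqrt (N%:R : R) by rewrite sqrtr_gt0 ltr0n ltnW.
  by rewrite -ler_pdivlMr// chord_cos_le// divr_ge0// ltW.
(* The absolute value calls for a lower bound: every tail contains an index at least 2, where the
   variance is nonnegative. *)
have lim0 : (0 <= limn_esup V)%E.
  rewrite /limn_esup limf_esupE; apply: le_ereal_inf_tmp => _ [A [n _ An] <-].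
  apply: le_ereal_sup_tmp; exists (V (maxn n 2)).
    by exists (maxn n 2) => //; apply: An; rewrite /= leq_maxl.
  by case/andP: (Vb (maxn n 2) (leq_maxr _ _)).
rewrite gee0_abs// /limn_esup limf_esupE; apply: ereal_inf_le.
exists (ereal_sup (V @` [set N | (1 < N)%N])).
  by exists [set N | (1 < N)%N] => //; exact: nbhs_infty_gt.
by apply: ge_ereal_sup => _ [N N1 <-]; case/andP: (Vb N N1).
Unshelve. all: by end_near. Qed.

End Regimes.

Theorem theorem1 (R : realType) (X : forall N : nat, point_process R N)
    (hX : forall N : nat, (0 < N)%N -> spherical_ensemble (X N)) :
  [/\ hyperuniform_large_caps X,
      hyperuniform_small_caps X &
      hyperuniform_threshold X].
Proof.
by split; [exact: large_caps|exact: small_caps|exact: threshold].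
Qed.
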